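(* Let $\Bbbk$ be a field and let $A=A_\mu(R,\boldsymbol\partial,\mathbf a)$ and $A'=A_{\mu'}(R',\boldsymbol\partial',\mathbf a')$ be twisted generalized Weyl Poisson algebras (TGWPAs) of type $(A_1)^n$ and $(A_1)^m$, of rank $n$ and $m$, respectively. Set $S=R\otimes R'$ and $\nu=\mu\oplus\mu'$ (block diagonal, so $\nu_{ij}=0$ when exactly one of $i,j$ is at most $n$). Define $\boldsymbol\nabla=(\nabla_1,\dots,\nabla_{n+m})$ and $\mathbf b=(b_1,\dots,b_{n+m})$ by $$\nabla_i=\begin{cases}\partial_i\otimes1&1\le i\le n\\1\otimes\partial'_{i-n}&n+1\le i\le n+m,\end{cases}\qquad b_i=\begin{cases}a_i\otimes1&1\le i\le n\\1\otimes a'_{i-n}&n+1\le i\le n+m,\end{cases}$$ where the $1$ in $\nabla_i$ denotes the identity map. Then $A\otimes A'=A_\nu(S,\boldsymbol\nabla,\mathbf b)$ as Poisson algebras (under the canonical identification of generators).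
   Context: All algebras are over a field $\Bbbk$ and $\otimes=\otimes_\Bbbk$. A Poisson algebra is a commutative algebra $R$ with a Lie bracket $\{,\}$ such that each $\{r,-\}$ is a derivation. A derivation $\partial$ of $R$ is a Poisson derivation if $\partial(\{r,s\})=\{\partial(r),s\}+\{r,\partial(s)\}$ for all $r,s$. An element $a$ is Poisson central if $\{a,-\}=0$. For Poisson algebras $B,C$, the tensor product $B\otimes C$ carries the Poisson bracket $\{b_1\otimes c_1,b_2\otimes c_2\}=\{b_1,b_2\}\otimes c_1c_2+b_1b_2\otimes\{c_1,c_2\}$. TGWPA of type $(A_1)^n$: Fix an integer $n\ge 1$. Let $R$ be a Poisson algebra, $\boldsymbol\partial=(\partial_1,\dots,\partial_n)$ an $n$-tuple of pairwise commuting Poisson derivations of $R$, and $\mathbf a=(a_1,\dots,a_n)$ an $n$-tuple of Poisson central regular (non-zero-divisor) elements of $R$. Assume there are scalars $\mu_{ij},\gamma_{ij}\in\Bbbk$ ($i\ne j$) with $\partial_j(a_i)=\gamma_{ij}a_i$ and $\gamma_{ij}+\gamma_{ji}=\mu_{ij}+\mu_{ji}$ for all $i\neq j$. Then $A_\mu(R,\boldsymbol\partial,\mathbf a)$ is the algebra $R[x_1,y_1,\dots,x_n,y_n]/(y_1x_1-a_1,\dots,y_nx_n-a_n)$ with Poisson bracket extending that of $R$ and given by $\{r,x_i\}=\partial_i(r)x_i$, $\{r,y_i\}=-\partial_i(r)y_i$, $\{y_i,x_i\}=\partial_i(a_i)$ for all $i$ and $r\in R$, and $\{y_i,x_j\}=\mu_{ij}x_jy_i$,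 $\{x_i,x_j\}=(\gamma_{ij}-\mu_{ij})x_ix_j$, $\{y_i,y_j\}=(\mu_{ji}-\gamma_{ij})y_iy_j$ for $i\ne j$. *)

(* Defs.v *)
From HB Require Import structures.
From mathcomp Require Import all_boot all_order all_algebra.
From mathcomp Require Import boolp classical_sets.
From mathcomp Require Import freeg mpoly.
From mathcomp Require Import ring.

Set Implicit Arguments.
Unset Strict Implicit.
Unset Printing Implicit Defensive.

Import GRing.Theory.
Local Open Scope ring_scope.
Local Open Scope quotient_scope.

HB.mixin Record isPoisson (k : fieldType) A of GRing.ComAlgebra k A := {
  pbr : A -> A -> A;
  pbr_linearl : forall s, linear (pbr^~ s);
  pbr_linearr : forall r, linear (pbr r);
  pbrxx : forall r, pbr r r = 0;
  pbr_jacobi : forall r s t,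
    pbr r (pbr s t) + pbr s (pbr t r) + pbr t (pbr r s) = 0;
  pbr_leibniz : forall r s t, pbr r (s * t) = pbr r s * t + s * pbr r t
}.

(* As everywhere in MathComp's comAlgType, 1 != 0. *)
#[short(type="poissonAlgType")]
HB.structure Definition Poisson (k : fieldType) :=
  {A of isPoisson k A & GRing.ComAlgebra k A}.

Definition poisson_morph (k : fieldType) (A B : poissonAlgType k)
  (f : A -> B) : Prop := {morph f : r s / pbr r s}.

Definition poisson_central (k : fieldType) (A : poissonAlgType k) (a : A) :
  Prop := forall r, pbr a r = 0.

Definition poisson_derivation (k : fieldType) (A : poissonAlgType k)
  (d : A -> A) : Prop :=
  [/\ linear d,
      forall r s, d (r * s) = d r * s + r * d s
    & forall r s, d (pbr r s) = pbr (d r) s + pbr r (d s)].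

Section PoissonTheory.
Variables (k : fieldType) (A : poissonAlgType k).
Implicit Types r s t : A.

Lemma pbrDl s : {morph pbr^~ s : r t / r + t}.
Proof. by move=> r t; have /= := pbr_linearl s 1 r t; rewrite !scale1r. Qed.
Lemma pbrDr r : {morph pbr r : s t / s + t}.
Proof. by move=> s t; have := pbr_linearr r 1 s t; rewrite !scale1r. Qed.
Lemma pbr0l s : pbr 0 s = 0 :> A.
Proof. by apply: (addrI (pbr 0 s)); rewrite -pbrDl !addr0. Qed.
Lemma pbr0r r : pbr r 0 = 0.
Proof. by apply: (addrI (pbr r 0)); rewrite -pbrDr !addr0. Qed.
Lemma pbrZl a r s : pbr (a *: r) s = a *: pbr r s.
Proof. by have /= := pbr_linearl s a r 0; rewrite !addr0 pbr0l addr0. Qed.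
Lemma pbrZr a r s : pbr r (a *: s) = a *: pbr r s.
Proof. by have /= := pbr_linearr r a s 0; rewrite !addr0 pbr0r addr0. Qed.
Lemma pbrC r s : pbr r s = - pbr s r.
Proof.
apply/eqP; rewrite -addr_eq0 -[X in _ == X](pbrxx (r + s)).
by rewrite pbrDl !pbrDr !pbrxx addr0 add0r.
Qed.
Lemma pbrNl r s : pbr (- r) s = - pbr r s.
Proof. by rewrite -scaleN1r pbrZl scaleN1r. Qed.
Lemma pbrNr r s : pbr r (- s) = - pbr r s.
Proof. by rewrite -scaleN1r pbrZr scaleN1r. Qed.
Lemma pbr1r r : pbr r 1 = 0.
Proof.
have := pbr_leibniz r 1 1; rewrite !mulr1 mul1r => /eqP.
by rewrite -subr_eq0 opprD addrA subrr sub0r oppr_eq0 => /eqP.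
Qed.
Lemma pbr1l r : pbr 1 r = 0.
Proof. by rewrite pbrC pbr1r oppr0. Qed.
Lemma pbr_leibnizl r s t : pbr (r * s) t = pbr r t * s + r * pbr s t.
Proof.
rewrite pbrC pbr_leibniz [pbr t r]pbrC [pbr t s]pbrC; ring.
Qed.

End PoissonTheory.

(* Alternation and the Jacobi identity of a skew-symmetric biderivation only
   have to be checked on a generating set. *)
Section Biderivation.
Variables (M : comNzRingType) (br : M -> M -> M) (G : M -> Prop).
Hypothesis brDr : forall x, {morph br x : y z / y + z}.
Hypothesis brC : forall x y, br x y = - br y x.
Hypothesis brMr : forall x y z, br x (y * z) = br x y * z + y * br x z.
Hypothesis genG : forall P : M -> Prop,
  (forall x y, P x -> P y -> P (x + y)) ->
  (forall x y, P x -> P y -> P (x * y)) ->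
  (forall x, G x -> P x) -> forall x, P x.

Lemma bider0 x : br x 0 = 0.
Proof. by apply: (addrI (br x 0)); rewrite -brDr !addr0. Qed.
Lemma biderN x y : br x (- y) = - br x y.
Proof. by apply: (addrI (br x y)); rewrite -brDr !subrr bider0. Qed.
Lemma biderDl x : {morph br^~ x : y z / y + z}.
Proof. by move=> y z /=; rewrite ![br _ x]brC brDr opprD. Qed.
Lemma biderNl x y : br (- x) y = - br x y.
Proof. by rewrite brC biderN [br y x]brC opprK. Qed.

Lemma bider_alt : (forall x, G x -> br x x = 0) -> forall x, br x x = 0.
Proof.
move=> brG; apply: genG => // x y x0 y0.
  by rewrite brDr !biderDl x0 y0 [br y x]brC; ring.
rewrite brMr ![br (x * y) _]brC !brMr x0 y0 [br y x]brC; ring.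
Qed.

Definition jacobiator x y z := br x (br y z) + br y (br z x) + br z (br x y).

Lemma jacobiatorC x y z : jacobiator x y z = jacobiator y z x.
Proof. by rewrite /jacobiator; ring. Qed.

Lemma jacobiator_swap x y z : jacobiator x y z = - jacobiator y x z.
Proof.
rewrite /jacobiator [br y z]brC [br z x]brC [br x y]brC !biderN; ring.
Qed.

Lemma bider_jacobi_r x y : (forall z, G z -> jacobiator x y z = 0) ->
  forall z, jacobiator x y z = 0.
Proof.
move=> JG; apply: genG => // z t; rewrite /jacobiator => Hz Ht.
  by rewrite -[RHS](addr0 0) -{1}Hz -[in RHS]Ht !(brDr, biderDl); ring.
suff -> : br x (br y (z * t)) + br y (br (z * t) x) + br (z * t) (br x y) =
  (br x (br y z) + br y (br z x) + br z (br x y)) * t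
  + z * (br x (br y t) + br y (br t x) + br t (br x y)).
  by rewrite Hz Ht mul0r mulr0 addr0.
rewrite ![br (z * t) _]brC ![br z _]brC ![br t _]brC.
by rewrite !(brMr, brDr, biderN); ring.
Qed.

Lemma bider_jacobi :
  (forall x y z, G x -> G y -> G z -> jacobiator x y z = 0) ->
  forall x y z, jacobiator x y z = 0.
Proof.
move=> JG x y; apply: bider_jacobi_r => z Gz.
move: x y; suff H x y : jacobiator z x y = 0.
  by move=> x y; rewrite -jacobiatorC.
move: y; apply: bider_jacobi_r => y Gy.
rewrite jacobiatorC jacobiatorC; move: x; apply: bider_jacobi_r => x Gx.
exact: JG.
Qed.

End Biderivation.

(* Needed only to see that a tensor product of nonzero algebras is nonzero. *)
Lemma linear_functional_exists (k : fieldType) (V : lmodType k) (w : V) :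
  w != 0 -> exists2 f : V -> k, (forall a u v, f (a *: u + v) = a * f u + f v)
                              & f w = 1.
Proof.
move=> w0.
pose P (H : set V) := (forall a u v, H u -> H v -> H (a *: u + v)) /\ ~ H w.
have [H [[Hlin Hw] Hmax]] : exists H, P H /\ forall B, (H `<` B)%classic -> ~ P B.
  apply: Zorn_bigcup => F FP totF; split; last by move=> [H FH]; apply: (FP _ FH).2.
  move=> a u v [H FH Hu] [K FK Kv].
  have [HK|KH] := totF _ _ FH FK.
    by exists K => //; apply: (FP _ FK).1 => //; apply: HK.
  by exists H => //; apply: (FP _ FH).1 => //; apply: KH.
have H0 : H 0.
  apply: contrapT => nH0; apply: (Hmax [set 0]%classic).
    split=> [|sub]; last by apply: nH0; apply: sub.
    move=> u Hu; exfalso; apply: nH0.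
    by rewrite -(subrr u) addrC -scaleN1r; apply: Hlin.
  by split=> [a u v -> ->|/= w00]; [rewrite scaler0 addr0 | rewrite w00 eqxx in w0].
have HZ a u : H u -> H (a *: u) by move=> Hu; rewrite -[_ *: _]addr0; apply: Hlin.
have Hex v : exists c, H (v - c *: w).
  apply: contrapT => nex.
  have nHv : ~ H v by move=> Hv; apply: nex; exists 0; rewrite scale0r subr0.
  apply: (Hmax [set u | exists2 c, True & H (u - c *: v)]%classic).
    split=> [u Hu|sub]; first by exists 0 => //; rewrite scale0r subr0.
    by apply: nHv; apply: sub; exists 1 => //; rewrite scale1r subrr.
  split=> [a u u' [c _ Hc] [c' _ Hc']|[c _ Hc]].
    exists (a * c + c') => //.
    have -> : a *: u + u' - (a * c + c') *: v = a *: (u - c *: v) + (u' - c' *: v).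
      by rewrite scalerBr scalerDl scalerA opprD addrACA.
    exact: Hlin.
  have [c0|c0] := eqVneq c 0; first by rewrite c0 scale0r subr0 in Hc.
  apply: nex; exists c^-1.
  have -> : v - c^-1 *: w = (- c^-1) *: (w - c *: v).
    by rewrite scalerBr !scaleNr opprK scalerA mulVf // scale1r addrC.
  exact: HZ.
have uniqc v c c' : H (v - c *: w) -> H (v - c' *: w) -> c = c'.
  move=> Hc Hc'; apply/eqP; rewrite -subr_eq0; apply: contrapT => /negP cc.
  apply: Hw; have -> : w = (c - c')^-1 *: ((-1) *: (v - c *: w) + (v - c' *: w)).
    rewrite scaleN1r opprB addrA subrK -scalerBl scalerA mulVf // scale1r //.
  by apply: HZ; apply: Hlin.
pose f v := xget 0 [set c | H (v - c *: w)]%classic.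
have fP v : H (v - f v *: w).
  by rewrite /f; case: xgetP => [c _ //|noc]; case: (Hex v) => c /noc.
exists f.
  move=> a u v; apply: (uniqc (a *: u + v)) => //.
  have -> : a *: u + v - (a * f u + f v) *: w
          = a *: (u - f u *: w) + (v - f v *: w).
    by rewrite scalerBr scalerDl scalerA opprD addrACA.
  exact: Hlin.
by apply: (uniqc w) => //; rewrite scale1r subrr.
Qed.

Section TensorSpace.
Variables (k : fieldType) (B C : lmodType k).

(* The subspace of the free vector space on B * C generated by the bilinearity
   relations. *)
Inductive bilinear_rel : {freeg (B * C) / k} -> Prop :=
| BilinearRel0 : bilinear_rel 0
| BilinearRelD a D D' of bilinear_rel D & bilinear_rel D' :
    bilinear_rel (a *: D + D')
| BilinearRelL a b b' c :
    bilinear_rel (<< (a *: b + b', c) >> - (a *: << (b, c) >> + << (b', c) >>))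
| BilinearRelR a b c c' :
    bilinear_rel (<< (b, a *: c + c') >> - (a *: << (b, c) >> + << (b, c') >>)).

Definition bilinear_relb (D : {freeg (B * C) / k}) : bool :=
  `[< bilinear_rel D >].

Lemma bilinear_relb_zmod : zmod_closed bilinear_relb.
Proof.
split=> [|D D' /asboolP HD /asboolP HD']; apply/asboolP.
  exact: BilinearRel0.
by rewrite addrC -scaleN1r; apply: BilinearRelD.
Qed.

HB.instance Definition _ :=
  GRing.isZmodClosed.Build {freeg (B * C) / k} bilinear_relb bilinear_relb_zmod.

Definition tensor : Type := 
  {ideal_quot (GRing.ZmodClosed.clone {freeg (B * C) / k} bilinear_relb _)}.
HB.instance Definition _ := GRing.Zmodule.on tensor.
HB.instance Definition _ := Quotient.on tensor.

Definition tens_pi (D : {freeg (B * C) / k}) : tensor := \pi_tensor D.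

Definition pure_tensor (b : B) (c : C) : tensor := tens_pi << (b, c) >>.

Lemma tens_piD D D' : tens_pi (D + D') = tens_pi D + tens_pi D'.
Proof. exact: Quotient.pi_add. Qed.

Lemma tens_piP D D' : tens_pi D = tens_pi D' <-> bilinear_rel (D - D').
Proof.
split=> [/eqP|H]; last apply/eqP.
  by rewrite -Quotient.idealrBE => /asboolP.
by rewrite -Quotient.idealrBE; apply/asboolP.
Qed.

End TensorSpace.

Notation "b ⊗ c" := (pure_tensor b c) (at level 40, left associativity).

Section TensorModule.
Variables (k : fieldType) (B C : lmodType k).
Local Notation T := (tensor B C).
Implicit Types (x y z : T) (D : {freeg (B * C) / k}).

Lemma tens_piZ a D D' : tens_pi D = tens_pi D' ->
  tens_pi (a *: D) = tens_pi (a *: D').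
Proof.
move=> /tens_piP H; apply/tens_piP; rewrite -scalerBr -[_ *: _]addr0.
by apply: BilinearRelD => //; apply: BilinearRel0.
Qed.

Lemma tens_reprK x : tens_pi (repr x) = x.
Proof. exact: reprK. Qed.

Definition tens_scale a x : T := tens_pi (a *: repr x).

Lemma tens_scaleE a D : tens_scale a (tens_pi D) = tens_pi (a *: D).
Proof. by apply: tens_piZ; rewrite tens_reprK. Qed.

Lemma tens_scaleA a b x : tens_scale a (tens_scale b x) = tens_scale (a * b) x.
Proof. by rewrite -[x]tens_reprK !tens_scaleE scalerA. Qed.
Lemma tens_scale1 : left_id 1 tens_scale.
Proof. by move=> x; rewrite -[x]tens_reprK tens_scaleE scale1r. Qed.
Lemma tens_scaleDr : right_distributive tens_scale +%R.
Proof.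
move=> a x y; rewrite -[x]tens_reprK -[y]tens_reprK.
by rewrite -tens_piD !tens_scaleE scalerDr tens_piD.
Qed.
Lemma tens_scaleDl x : {morph tens_scale^~ x : a b / a + b}.
Proof.
move=> a b /=; rewrite -[x]tens_reprK.
by rewrite !tens_scaleE scalerDl tens_piD.
Qed.

HB.instance Definition _ := GRing.Zmodule_isLmodule.Build k T
  tens_scaleA tens_scale1 tens_scaleDr tens_scaleDl.

Lemma tens_piZE a D : a *: tens_pi D = tens_pi (a *: D).
Proof. exact: tens_scaleE. Qed.

Lemma tens_pi_linear a D D' : tens_pi (a *: D + D') = a *: tens_pi D + tens_pi D'.
Proof. by rewrite tens_piD -tens_scaleE. Qed.

Lemma tensor_linearl c : linear (fun b => b ⊗ c : T).
Proof. move=> a b b'; rewrite -tens_pi_linear; apply/tens_piP; exact: BilinearRelL. Qed.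
Lemma tensor_linearr b : linear (fun c => b ⊗ c : T).
Proof. move=> a c c'; rewrite -tens_pi_linear; apply/tens_piP; exact: BilinearRelR. Qed.

Lemma tensorDl b b' c : (b + b') ⊗ c = b ⊗ c + b' ⊗ c :> T.
Proof. by have := tensor_linearl c 1 b b'; rewrite !scale1r. Qed.
Lemma tensorDr b c c' : b ⊗ (c + c') = b ⊗ c + b ⊗ c' :> T.
Proof. by have := tensor_linearr b 1 c c'; rewrite !scale1r. Qed.
Lemma tensor0l c : 0 ⊗ c = 0 :> T.
Proof. by apply: (addrI (0 ⊗ c)); rewrite -tensorDl !addr0. Qed.
Lemma tensor0r b : b ⊗ 0 = 0 :> T.
Proof. by apply: (addrI (b ⊗ 0)); rewrite -tensorDr !addr0. Qed.
Lemma tensorZl a b c : (a *: b) ⊗ c = a *: (b ⊗ c) :> T.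
Proof. by have := tensor_linearl c a b 0; rewrite !addr0 tensor0l addr0. Qed.
Lemma tensorZr a b c : b ⊗ (a *: c) = a *: (b ⊗ c) :> T.
Proof. by have := tensor_linearr b a c 0; rewrite !addr0 tensor0r addr0. Qed.
Lemma tensorNl b c : (- b) ⊗ c = - (b ⊗ c) :> T.
Proof. by rewrite -scaleN1r tensorZl scaleN1r. Qed.
Lemma tensorNr b c : b ⊗ (- c) = - (b ⊗ c) :> T.
Proof. by rewrite -scaleN1r tensorZr scaleN1r. Qed.

Lemma tensor_ind (P : T -> Prop) :
  (forall x y, P x -> P y -> P (x + y)) -> (forall b c, P (b ⊗ c)) ->
  forall x, P x.
Proof.
move=> PD PU x; rewrite -[x]tens_reprK -[repr x]freeg_sumE.
elim: (dom _) => [|[b c] s IHs].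
  rewrite big_nil; have := PU 0 0; rewrite tensor0l; congr P.
  by rewrite -(scale0r (tens_pi 0)) tens_piZE scaler0.
rewrite big_cons tens_piD; apply: PD => //.
have -> : << coeff (b, c) (repr x) *g (b, c) >>
        = coeff (b, c) (repr x) *: << (b, c) >> :> {freeg (B * C) / k}.
  by apply/eqP/freeg_eqP => z; rewrite coeffZ !coeffU mul1r.
by rewrite -tens_piZE -/(_ ⊗ _) -tensorZl.
Qed.

End TensorModule.

Definition bilinear_map (k : fieldType) (B C V : lmodType k) (f : B -> C -> V) :=
  (forall c, linear (f^~ c)) /\ (forall b, linear (f b)).

Section TensorLift.
Variables (k : fieldType) (B C V : lmodType k).
Implicit Types f g : B -> C -> V.

Lemma fglift_linear (K : choiceType) (h : K -> V) a (D D' : {freeg K / k}) :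
  fglift h (a *: D + D') = a *: fglift h D + fglift h D'.
Proof.
pose L : {additive {freeg K / k} -> V} :=
  HB.pack (fglift h) (GRing.isZmodMorphism.Build _ _ _ (lift_is_additive h)).
have LE : fglift h =1 L by [].
rewrite !LE raddfD; congr (_ + _); rewrite -[in LHS](freeg_sumE D).
rewrite -[in RHS](freeg_sumE D) scaler_sumr !raddf_sum /=.
apply: eq_bigr => x _; rewrite -?LE.
have -> : a *: << coeff x D *g x >> = << a * coeff x D *g x >>.
  by apply/eqP/freeg_eqP => z; rewrite coeffZ !coeffU mulrA.
by rewrite !liftU scalerA.
Qed.

(* The linear map induced by a bilinear map f; meaningless otherwise. *)
Definition tlift f (x : tensor B C) : V := fglift (fun p => f p.1 p.2) (repr x).

Lemma tlift_pi f D : bilinear_map f ->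
  tlift f (tens_pi D) = fglift (fun p => f p.1 p.2) D.
Proof.
move=> [fl fr]; rewrite /tlift; set h := fun p => _.
have hN1 D1 D2 : fglift h (D1 - D2) = fglift h D1 - fglift h D2.
  by have := fglift_linear h (-1) D2 D1; rewrite !scaleN1r ![- _ + _]addrC.
have h0 : fglift h 0 = 0 by rewrite -(subrr 0) hN1 subrr.
have hU p : fglift h << p >> = h p by rewrite liftU scale1r.
have h_rel E : bilinear_rel E -> fglift h E = 0.
  elim=> [|a E1 E2 _ E10 _ E20|a b b' c|a b c c'] //.
  - by rewrite fglift_linear E10 E20 scaler0 addr0.
  - by rewrite hN1 fglift_linear !hU /h /= fl subrr.
  - by rewrite hN1 fglift_linear !hU /h /= fr subrr.
apply/eqP; rewrite -subr_eq0 -hN1; apply/eqP/h_rel/tens_piP.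
exact: tens_reprK.
Qed.

Lemma tliftE f b c : bilinear_map f -> tlift f (b ⊗ c) = f b c.
Proof. by move=> Hf; rewrite tlift_pi // liftU scale1r. Qed.

Lemma tlift_linear f : bilinear_map f -> linear (tlift f).
Proof.
move=> Hf a x y; rewrite -[x]tens_reprK -[y]tens_reprK -tens_pi_linear.
by rewrite !tlift_pi // fglift_linear.
Qed.

Lemma eq_tlift f g : (forall b c, f b c = g b c) -> tlift f =1 tlift g.
Proof. by move=> fg; have -> : f = g by apply/funext => b; apply/funext. Qed.

Lemma tlift_fun_linear f g a x :
  tlift (fun b c => a *: f b c + g b c) x = a *: tlift f x + tlift g x.
Proof.
rewrite /tlift -[repr x]Freeg_enum !fglift_Freeg /prelift scaler_sumr -big_split.
apply: eq_bigr => p _ /=.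
by rewrite scalerDr !scalerA mulrC.
Qed.

End TensorLift.

Section TensorLift2.
Variables (k : fieldType) (B C B' C' V : lmodType k).
Variable f : B -> C -> B' -> C' -> V.
Hypothesis fl : forall b' c', bilinear_map (fun b c => f b c b' c').
Hypothesis fr : forall b c, bilinear_map (f b c).

Definition tlift2 (x : tensor B C) (y : tensor B' C') : V :=
  tlift (fun b c => tlift (f b c) y) x.

Lemma tlift2_bilin y : bilinear_map (fun b c => tlift (f b c) y).
Proof.
split=> [c a b1 b2|b a c1 c2] /=; rewrite -tlift_fun_linear; apply: eq_tlift.
  by move=> b' c'; rewrite (fl b' c').1.
by move=> b' c'; rewrite (fl b' c').2.
Qed.

Lemma tlift2E b c b' c' : tlift2 (b ⊗ c) (b' ⊗ c') = f b c b' c'.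
Proof. by rewrite /tlift2 tliftE ?tliftE //; apply: tlift2_bilin. Qed.

Lemma tlift2_linearl y : linear (tlift2^~ y).
Proof. exact/tlift_linear/tlift2_bilin. Qed.

Lemma tlift2_linearr x : linear (tlift2 x).
Proof.
move=> a y1 y2; rewrite /tlift2 -tlift_fun_linear; apply: eq_tlift => b c.
exact: tlift_linear.
Qed.

Lemma tlift2Dl y : {morph tlift2^~ y : x x' / x + x'}.
Proof. by move=> x x'; have := tlift2_linearl y 1 x x'; rewrite !scale1r. Qed.
Lemma tlift2Dr x : {morph tlift2 x : y y' / y + y'}.
Proof. by move=> y y'; have := tlift2_linearr x 1 y y'; rewrite !scale1r. Qed.

End TensorLift2.

Section TensorAlgebra.
Variables (k : fieldType) (B C : comAlgType k).
Local Notation T := (tensor B C).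
Implicit Types x y z : T.

Definition tens_mul : T -> T -> T :=
  tlift2 (fun b c b' c' => (b * b') ⊗ (c * c')).

Let mul_bilinl (b' : B) (c' : C) :
  bilinear_map (fun (b : B) (c : C) => (b * b') ⊗ (c * c') : T).
Proof.
by split=> [c a b1 b2|b a c1 c2] /=;
  rewrite mulrDl -scalerAl ?tensor_linearl ?tensor_linearr.
Qed.
Let mul_bilinr (b : B) (c : C) :
  bilinear_map (fun (b' : B) (c' : C) => (b * b') ⊗ (c * c') : T).
Proof.
by split=> [c' a b1 b2|b' a c1 c2] /=;
  rewrite mulrDr -scalerAr ?tensor_linearl ?tensor_linearr.
Qed.

Let mulE b c b' c' : tens_mul (b ⊗ c) (b' ⊗ c') = (b * b') ⊗ (c * c').
Proof. exact: tlift2E. Qed.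
Let mulDl : left_distributive tens_mul +%R.
Proof. by move=> x y z; apply: tlift2Dl. Qed.
Let mulDr : right_distributive tens_mul +%R.
Proof. by move=> x y z; apply: tlift2Dr. Qed.

Lemma tens_mulC : commutative tens_mul.
Proof.
elim/tensor_ind=> [x x' Hx Hx' y|b c]; first by rewrite mulDl mulDr Hx Hx'.
elim/tensor_ind=> [y y' Hy Hy'|b' c']; first by rewrite mulDl mulDr Hy Hy'.
by rewrite !mulE mulrC [c * _]mulrC.
Qed.

Lemma tens_mulA : associative tens_mul.
Proof.
elim/tensor_ind=> [x x' Hx Hx' y z|b c]; first by rewrite !mulDl Hx Hx'.
elim/tensor_ind=> [y y' Hy Hy' z|b' c'].
  by rewrite mulDl !mulDr mulDl Hy Hy'.
elim/tensor_ind=> [z z' Hz Hz'|b'' c'']; first by rewrite !mulDr Hz Hz'.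
by rewrite !mulE !mulrA.
Qed.

Lemma tens_mul1 : left_id (1 ⊗ 1) tens_mul.
Proof.
elim/tensor_ind=> [x x' Hx Hx'|b c]; first by rewrite mulDr Hx Hx'.
by rewrite mulE !mul1r.
Qed.

Lemma tensor11_neq0 : 1 ⊗ 1 != 0 :> T.
Proof.
have [f f_lin f1] := linear_functional_exists (oner_neq0 B).
have fb : bilinear_map (fun b c => f b *: c : C).
  split=> [c a b b'|b a c c'] /=; first by rewrite f_lin scalerDl scalerA.
  by rewrite scalerDr !scalerA mulrC.
apply: contraNneq (oner_neq0 C) => T0.
have <- : tlift (fun b c => f b *: c) (1 ⊗ 1 : T) = 1 by rewrite tliftE // f1 scale1r.
rewrite T0 -(tensor0l B (1 : C)) tliftE //.
have := fb.1 1 (-1) 0 0; rewrite /= scaler0 addr0 scaleN1r => ->.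
by rewrite addNr.
Qed.

HB.instance Definition _ := GRing.Zmodule_isComNzRing.Build T
  tens_mulA tens_mulC tens_mul1 mulDl tensor11_neq0.

Lemma tensorM b c b' c' : (b ⊗ c) * (b' ⊗ c') = (b * b') ⊗ (c * c') :> T.
Proof. exact: mulE. Qed.

Lemma tensor1 : 1 = 1 ⊗ 1 :> T. Proof. by []. Qed.

Lemma tens_scalerAl (a : k) (x y : T) : a *: (x * y) = (a *: x) * y.
Proof.
elim/tensor_ind: y => [y y' Hy Hy'|b' c'].
  by rewrite !mulrDr scalerDr Hy Hy'.
elim/tensor_ind: x => [x x' Hx Hx'|b c].
  by rewrite scalerDr !mulrDl scalerDr Hx Hx'.
by rewrite -tensorZl !tensorM -scalerAl tensorZl.
Qed.

HB.instance Definition _ := GRing.Lmodule_isLalgebra.Build k T tens_scalerAl.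
HB.instance Definition _ := GRing.Lalgebra_isComAlgebra.Build k T.

End TensorAlgebra.

Section TensorPoisson.
Variables (k : fieldType) (B C : poissonAlgType k).
Local Notation T := (tensor B C).
Implicit Types x y z : T.

Definition tens_pbr : T -> T -> T :=
  tlift2 (fun b c b' c' => pbr b b' ⊗ (c * c') + (b * b') ⊗ pbr c c').

Let br_bilinl (b' : B) (c' : C) :
  bilinear_map (fun b c => pbr b b' ⊗ (c * c') + (b * b') ⊗ pbr c c' : T).
Proof.
split=> [c a b1 b2|b a c1 c2] /=;
  rewrite mulrDl pbrDl pbrZl -scalerAl ?(tensorDl, tensorDr, tensorZl, tensorZr);
  by rewrite scalerDr addrACA.
Qed.
Let br_bilinr (b : B) (c : C) :
  bilinear_map (fun b' c' => pbr b b' ⊗ (c * c') + (b * b') ⊗ pbr c c' : T).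
Proof.
split=> [c' a b1 b2|b' a c1 c2] /=;
  rewrite mulrDr pbrDr pbrZr -scalerAr ?(tensorDl, tensorDr, tensorZl, tensorZr);
  by rewrite scalerDr addrACA.
Qed.

Lemma tens_pbrE b c b' c' : tens_pbr (b ⊗ c) (b' ⊗ c')
  = pbr b b' ⊗ (c * c') + (b * b') ⊗ pbr c c'.
Proof. exact: tlift2E. Qed.

Lemma tens_pbr_linearl y : linear (tens_pbr^~ y).
Proof. exact: tlift2_linearl. Qed.
Lemma tens_pbr_linearr x : linear (tens_pbr x).
Proof. exact: tlift2_linearr. Qed.
Let brDl y : {morph tens_pbr^~ y : x x' / x + x'}.
Proof. exact: tlift2Dl. Qed.
Let brDr x : {morph tens_pbr x : y y' / y + y'}.
Proof. exact: tlift2Dr. Qed.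

Let brC x y : tens_pbr x y = - tens_pbr y x.
Proof.
elim/tensor_ind: y => [y y' Hy Hy'|b' c'].
  by rewrite brDr brDl Hy Hy' opprD.
elim/tensor_ind: x => [x x' Hx Hx'|b c].
  by rewrite brDr brDl Hx Hx' opprD.
rewrite !tens_pbrE [pbr b' b]pbrC [pbr c' c]pbrC tensorNl tensorNr.
by rewrite opprD !opprK [c' * c]mulrC [b' * b]mulrC.
Qed.

Lemma tens_pbr_leibniz x y z :
  tens_pbr x (y * z) = tens_pbr x y * z + y * tens_pbr x z.
Proof.
elim/tensor_ind: x => [x x' Hx Hx'|b c].
  by rewrite !brDl Hx Hx' mulrDl mulrDr addrACA.
elim/tensor_ind: y => [y y' Hy Hy'|b' c'].
  by rewrite mulrDl !brDr Hy Hy' !mulrDl addrACA.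
elim/tensor_ind: z => [z z' Hz Hz'|b'' c''].
  by rewrite !mulrDr !brDr Hz Hz' !mulrDr addrACA.
rewrite tensorM !tens_pbrE mulrDl mulrDr !tensorM !pbr_leibniz.
rewrite tensorDl tensorDr addrACA.
by congr (_ ⊗ _ + _ ⊗ _ + (_ ⊗ _ + _ ⊗ _)); ring.
Qed.

Let gen x := (exists b, x = b ⊗ 1) \/ (exists c, x = 1 ⊗ c).

Let genP (P : T -> Prop) :
  (forall x y, P x -> P y -> P (x + y)) ->
  (forall x y, P x -> P y -> P (x * y)) ->
  (forall x, gen x -> P x) -> forall x, P x.
Proof.
move=> PD PM PG; apply: tensor_ind => // b c.
have -> : b ⊗ c = (b ⊗ 1) * (1 ⊗ c) :> T by rewrite tensorM mulr1 mul1r.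
by apply: PM; apply: PG; [left; exists b | right; exists c].
Qed.

Let br11 b b' : tens_pbr (b ⊗ 1) (b' ⊗ 1) = pbr b b' ⊗ 1.
Proof. by rewrite tens_pbrE pbr1r tensor0r addr0 mulr1. Qed.
Let br22 c c' : tens_pbr (1 ⊗ c) (1 ⊗ c') = 1 ⊗ pbr c c'.
Proof. by rewrite tens_pbrE pbr1r tensor0l add0r mulr1. Qed.
Let br12 b c : tens_pbr (b ⊗ 1) (1 ⊗ c) = 0.
Proof. by rewrite tens_pbrE pbr1r pbr1l tensor0r tensor0l addr0. Qed.
Let br21 b c : tens_pbr (1 ⊗ c) (b ⊗ 1) = 0.
Proof. by rewrite brC br12 oppr0. Qed.
Let br0 x : tens_pbr x 0 = 0.
Proof. exact: bider0. Qed.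

Lemma tens_pbrxx x : tens_pbr x x = 0.
Proof.
move: x; apply: (bider_alt brDr brC tens_pbr_leibniz genP) => x.
by case=> -[u ->]; rewrite ?br11 ?br22 pbrxx ?tensor0l ?tensor0r.
Qed.

Lemma tens_pbr_jacobi x y z :
  tens_pbr x (tens_pbr y z) + tens_pbr y (tens_pbr z x)
    + tens_pbr z (tens_pbr x y) = 0.
Proof.
move: x y z.
apply: (bider_jacobi brDr brC tens_pbr_leibniz genP) => x y z; rewrite /jacobiator.
case=> -[u ->] [] [v ->] [] [w ->];
  do 4?[rewrite ?(br11, br22, br12, br21, br0)]; rewrite ?(addr0, add0r) //.
  by rewrite -!tensorDl pbr_jacobi tensor0l.
by rewrite -!tensorDr pbr_jacobi tensor0r.
Qed.

HB.instance Definition _ := isPoisson.Build k T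
  tens_pbr_linearl tens_pbr_linearr tens_pbrxx tens_pbr_jacobi tens_pbr_leibniz.

Lemma pbr_tensor b c b' c' : pbr (b ⊗ c) (b' ⊗ c')
  = pbr b b' ⊗ (c * c') + (b * b') ⊗ pbr c c' :> T.
Proof. exact: tens_pbrE. Qed.

End TensorPoisson.

Definition tensor_map (k : fieldType) (B C B' C' : lmodType k)
    (f : B -> B') (g : C -> C') : tensor B C -> tensor B' C' :=
  tlift (fun b c => f b ⊗ g c).

Lemma tensor_mapE (k : fieldType) (B C B' C' : lmodType k)
    (f : B -> B') (g : C -> C') b c : linear f -> linear g ->
  tensor_map f g (b ⊗ c) = f b ⊗ g c.
Proof.
move=> fL gL; rewrite /tensor_map tliftE //.
by split=> [{}c a b1 b2|{}b a c1 c2] /=; rewrite ?fL ?gL (tensor_linearl, tensor_linearr).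
Qed.

Record tgwpa_datum (k : fieldType) (R : poissonAlgType k) (n : nat) :=
  TGWPADatum {
  td_der : 'I_n -> R -> R;
  td_a : 'I_n -> R;
  (* the diagonal entries of mu and gamma are irrelevant *)
  td_mu : 'M[k]_n;
  td_gamma : 'M[k]_n;
  td_derP : forall i, poisson_derivation (td_der i);
  td_derC : forall i j r, td_der i (td_der j r) = td_der j (td_der i r);
  td_a_central : forall i, poisson_central (td_a i);
  td_a_regular : forall i, GRing.lreg (td_a i);
  td_der_a : forall i j, i != j ->
    td_der j (td_a i) = td_gamma i j *: td_a i;
  td_gamma_mu : forall i j, i != j ->
    td_gamma i j + td_gamma j i = td_mu i j + td_mu j i
}.

(* The derivation of the polynomial ring that agrees with d on coefficients
   and maps the i-th variable to h i. *)
Section PolynomialDerivation.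
Variables (R : comNzRingType) (N : nat).
Local Notation M := {mpoly R[N]}.

Definition mpoly_der (d : R -> M) (h : 'I_N -> M) (p : M) : M :=
  mmap d (fun i => 'X_i) p + \sum_(i < N) p^`M(i) * h i.

Lemma mpoly_der_lin d1 d2 h1 h2 (q1 q2 p : M) :
  mpoly_der (fun r => q1 * d1 r + q2 * d2 r) (fun i => q1 * h1 i + q2 * h2 i) p
  = q1 * mpoly_der d1 h1 p + q2 * mpoly_der d2 h2 p.
Proof.
rewrite /mpoly_der /mmap !mulrDr !mulr_sumr addrACA -!big_split /=.
congr (_ + _).
  apply: eq_bigr => m _.
  by rewrite mulrDl !mulrA.
by apply: eq_bigr => i _; ring.
Qed.

Lemma eq_mpoly_der d1 d2 h1 h2 : d1 =1 d2 -> h1 =1 h2 ->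
  mpoly_der d1 h1 =1 mpoly_der d2 h2.
Proof. by move=> /funext -> /funext ->. Qed.

Variables (d : R -> M) (h : 'I_N -> M).
Hypothesis dB : {morph d : r s / r - s}.
Hypothesis dM : forall r s, d (r * s) = d r * s%:MP + r%:MP * d s.

Let dmap : M -> M := mmap d (fun i => 'X_i).

Let dmapB : {morph dmap : p q / p - q}.
Proof.
pose dA : {additive R -> M} := HB.pack d (GRing.isZmodMorphism.Build _ _ d dB).
exact: (@mmap_is_additive _ _ _ (fun i => 'X_i) dA).
Qed.

Let dmap0 : dmap 0 = 0.
Proof. by rewrite -{1}(subrr 0) dmapB subrr. Qed.

Let dmapD : {morph dmap : p q / p + q}.
Proof.
by move=> p q; rewrite -{1}(opprK q) dmapB -(sub0r q) dmapB dmap0 sub0r opprK.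
Qed.

Let d0 : d 0 = 0. Proof. by rewrite -(subrr 0) dB subrr. Qed.

Let d1 : d 1 = 0.
Proof.
have := dM 1 1; rewrite !mulr1 mul1r => /eqP.
by rewrite -subr_eq0 opprD addrA subrr sub0r oppr_eq0 => /eqP.
Qed.

Let dmapZX r (m : 'X_{1..N}) : dmap (r *: 'X_[m]) = d r * 'X_[m].
Proof.
have [->|r0] := eqVneq r 0; first by rewrite scale0r dmap0 d0 mul0r.
rewrite /dmap /mmap (msuppMCX m r0) big_seq1.
by rewrite mcoeffZ mcoeffX eqxx mulr1 mmap1_id.
Qed.

Lemma mpoly_derC r : mpoly_der d h r%:MP = d r.
Proof.
rewrite /mpoly_der big1 ?addr0 => [|i _]; last by rewrite mderivC mul0r.
have := dmapZX r 0%MM; rewrite mpolyX0 mulr1 => <-.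
by rewrite -mul_mpolyC mulr1.
Qed.

Lemma mpoly_derX i : mpoly_der d h 'X_i = h i.
Proof.
rewrite /mpoly_der -[X in mmap _ _ X]scale1r -/(dmap _) dmapZX d1 mul0r add0r.
rewrite (bigD1 i) //= big1 => [|j ji]; rewrite mderivX mnm1E.
  by rewrite eqxx scale1r -[X in (X - _)%MM]add0m addmK mpolyX0 mul1r addr0.
by rewrite eq_sym (negPf ji) scale0r mul0r.
Qed.

Lemma mpoly_derD : {morph mpoly_der d h : p q / p + q}.
Proof.
move=> p q; rewrite /mpoly_der -!/(dmap _) dmapD addrACA -big_split /=.
by congr (_ + _); apply: eq_bigr => i _; rewrite mderivD mulrDl.
Qed.

Let dmapM p q : dmap (p * q) = dmap p * q + p * dmap q.
Proof.
elim/mpolyind: p => [|r m p _ _ IHp]; first by rewrite !(mul0r, dmap0) addr0.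
rewrite mulrDl !dmapD IHp !mulrDl addrACA; congr (_ + _).
elim/mpolyind: q {IHp} => [|s m' q _ _ IHq]; first by rewrite !(mulr0, dmap0) addr0.
rewrite mulrDr !dmapD IHq !mulrDr addrACA; congr (_ + _).
rewrite -scalerAl -scalerAr scalerA -mpolyXD !dmapZX dM mpolyXD -!mul_mpolyC.
ring.
Qed.

Lemma mpoly_derM p q :
  mpoly_der d h (p * q) = mpoly_der d h p * q + p * mpoly_der d h q.
Proof.
rewrite /mpoly_der -!/(dmap _) dmapM mulrDl mulrDr addrACA; congr (_ + _).
rewrite mulr_suml mulr_sumr -big_split /=; apply: eq_bigr => i _.
by rewrite mderivM; ring.
Qed.

End PolynomialDerivation.

Section TGWPA.
Variables (k : fieldType) (R : poissonAlgType k) (n : nat).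
Variable D : tgwpa_datum R n.

Local Notation M := {mpoly R[n + n]}.
Local Notation "'∂_' i" := (td_der D i) (at level 8, i at level 2).
Local Notation "'a_' i" := (td_a D i) (at level 8, i at level 2).
Local Notation μ := (td_mu D).
Local Notation γ := (td_gamma D).
Local Notation x_ i := ('X_(lshift n i) : M).
Local Notation y_ i := ('X_(rshift n i) : M).

Implicit Types (r s : R) (p q : M) (i j : 'I_n) (u v w : 'I_(n + n)).

Definition scal (c : k) : M := (c%:A)%:MP.

(* {r, z} = (var_der z r) z for each of the variables z. *)
Definition var_der u r : R :=
  match split u with inl i => ∂_ i r | inr i => - ∂_ i r end.

Definition pbr_yx i j : M :=
  if i == j then (∂_ i (a_ i))%:MP else scal (μ i j) * (x_ j * y_ i).

Definition pbr_var u v : M :=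
  match split u, split v with
  | inl i, inl j =>
      if i == j then 0 else scal (γ i j - μ i j) * (x_ i * x_ j)
  | inr i, inl j => pbr_yx i j
  | inl j, inr i => - pbr_yx i j
  | inr i, inr j =>
      if i == j then 0 else scal (μ j i - γ i j) * (y_ i * y_ j)
  end.

(* The biderivation of R[x_1, y_1, ..., x_n, y_n] given on generators by the
   defining formulas: poly_pbrC r = {r, -} and poly_pbrX u = {z_u, -} are
   derivations given on generators, and {p, -} maps the generators to
   - {r, p} and - {z_u, p}. *)
Definition poly_pbrC r : M -> M :=
  mpoly_der (fun s => (pbr r s)%:MP) (fun v => (var_der v r)%:MP * 'X_v).
Definition poly_pbrX u : M -> M :=
  mpoly_der (fun r => - ((var_der u r)%:MP * 'X_u)) (pbr_var u).
Definition poly_pbr p : M -> M :=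
  mpoly_der (fun s => - poly_pbrC s p) (fun v => - poly_pbrX v p).

Lemma td_derD i : {morph ∂_ i : r s / r + s}.
Proof.
by move=> r s; have [L _ _] := td_derP D i; have := L 1 r s; rewrite !scale1r.
Qed.
Lemma td_der0 i : ∂_ i 0 = 0.
Proof. by apply: (addrI (∂_ i 0)); rewrite -td_derD !addr0. Qed.
Lemma td_derZ i c r : ∂_ i (c *: r) = c *: ∂_ i r.
Proof.
have [L _ _] := td_derP D i.
by have := L c r 0; rewrite !addr0 td_der0 addr0.
Qed.
Lemma td_derN i r : ∂_ i (- r) = - ∂_ i r.
Proof. by rewrite -scaleN1r td_derZ scaleN1r. Qed.
Lemma td_derM i r s : ∂_ i (r * s) = ∂_ i r * s + r * ∂_ i s.
Proof. by have [_ L _] := td_derP D i; apply: L. Qed.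
Lemma td_der_pbr i r s : ∂_ i (pbr r s) = pbr (∂_ i r) s + pbr r (∂_ i s).
Proof. by have [_ _ L] := td_derP D i; apply: L. Qed.
Lemma td_der1 i : ∂_ i 1 = 0.
Proof.
have := td_derM i 1 1; rewrite !mulr1 mul1r => /eqP.
by rewrite -subr_eq0 opprD addrA subrr sub0r oppr_eq0 => /eqP.
Qed.

Lemma var_derD u : {morph var_der u : r s / r + s}.
Proof.
by move=> r s; rewrite /var_der; case: (split u) => i; rewrite td_derD ?opprD.
Qed.
Lemma var_derN u r : var_der u (- r) = - var_der u r.
Proof. by rewrite /var_der; case: (split u) => i; rewrite td_derN. Qed.
Lemma var_derB u : {morph var_der u : r s / r - s}.
Proof. by move=> r s; rewrite var_derD var_derN. Qed.
Lemma var_derM u r s : var_der u (r * s) = var_der u r * s + r * var_der u s.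
Proof.
by rewrite /var_der; case: (split u) => i; rewrite td_derM ?opprD ?mulNr ?mulrN.
Qed.
Lemma var_der_pbr u r s :
  var_der u (pbr r s) = pbr (var_der u r) s + pbr r (var_der u s).
Proof.
rewrite /var_der; case: (split u) => i; rewrite td_der_pbr //.
by rewrite opprD pbrNl pbrNr.
Qed.
Lemma var_der_comm u v r : var_der u (var_der v r) = var_der v (var_der u r).
Proof.
by rewrite /var_der; case: (split u) (split v) => i [] j; rewrite ?td_derN td_derC.
Qed.
Lemma var_der_scal u (c : k) : var_der u c%:A = 0.
Proof.
by rewrite /var_der; case: (split u) => i;
  rewrite td_derZ td_der1 scaler0 ?oppr0.
Qed.
Lemma var_derx i r : var_der (lshift n i) r = ∂_ i r.
Proof. by rewrite /var_der -[lshift n i]/(unsplit (inl i)) unsplitK. Qed.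
Lemma var_dery i r : var_der (rshift n i) r = - ∂_ i r.
Proof. by rewrite /var_der -[rshift n i]/(unsplit (inr i)) unsplitK. Qed.

Lemma pbr_varxx i j : pbr_var (lshift n i) (lshift n j) =
  if i == j then 0 else scal (γ i j - μ i j) * (x_ i * x_ j).
Proof.
by rewrite /pbr_var -[lshift n i]/(unsplit (inl i)) -[lshift n j]/(unsplit (inl j))
  !unsplitK.
Qed.
Lemma pbr_varyy i j : pbr_var (rshift n i) (rshift n j) =
  if i == j then 0 else scal (μ j i - γ i j) * (y_ i * y_ j).
Proof.
by rewrite /pbr_var -[rshift n i]/(unsplit (inr i)) -[rshift n j]/(unsplit (inr j))
  !unsplitK.
Qed.
Lemma pbr_varyx i j : pbr_var (rshift n i) (lshift n j) = pbr_yx i j.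
Proof.
by rewrite /pbr_var -[rshift n i]/(unsplit (inr i)) -[lshift n j]/(unsplit (inl j))
  !unsplitK.
Qed.
Lemma pbr_varxy i j : pbr_var (lshift n j) (rshift n i) = - pbr_yx i j.
Proof.
by rewrite /pbr_var -[rshift n i]/(unsplit (inr i)) -[lshift n j]/(unsplit (inl j))
  !unsplitK.
Qed.

Lemma scalD b c : scal (b + c) = scal b + scal c.
Proof. by rewrite /scal scalerDl mpolyCD. Qed.
Lemma scalN c : scal (- c) = - scal c.
Proof. by rewrite /scal scaleNr mpolyCN. Qed.
Lemma scalM b c : scal (b * c) = scal b * scal c.
Proof. by rewrite /scal -mpolyCM -scalerAl mul1r scalerA. Qed.
Lemma scal1 : scal 1 = 1.
Proof. by rewrite /scal scale1r. Qed.
Lemma scalZ c r : (c *: r)%:MP = scal c * r%:MP :> M.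
Proof. by rewrite /scal -mpolyCM -scalerAl mul1r. Qed.

Let gamE i j : i != j -> γ i j = μ i j + μ j i - γ j i.
Proof. by move=> ij; rewrite -td_gamma_mu // addrK. Qed.

Lemma pbr_varC u v : pbr_var u v = - pbr_var v u.
Proof.
case: (split_ordP u) => i ->; case: (split_ordP v) => j ->;
  rewrite ?pbr_varxx ?pbr_varyy ?pbr_varxy ?pbr_varyx ?opprK //;
  rewrite eq_sym; case: eqVneq => [_|ij]; rewrite ?oppr0 //.
  have -> : γ i j - μ i j = - (γ j i - μ j i).
    by rewrite gamE 1?eq_sym //; ring.
  by rewrite scalN mulNr [x_ i * _]mulrC.
have -> : μ j i - γ i j = - (μ i j - γ j i).
  by rewrite gamE 1?eq_sym //; ring.
by rewrite scalN mulNr [y_ i * _]mulrC.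
Qed.

Lemma pbr_varuu u : pbr_var u u = 0.
Proof.
by case: (split_ordP u) => i ->; rewrite ?pbr_varxx ?pbr_varyy eqxx.
Qed.

Let CdB r : {morph (fun s => (pbr r s)%:MP : M) : s t / s - t}.
Proof. by move=> s t /=; rewrite pbrDr pbrNr mpolyCB. Qed.
Let CdM r s t : (pbr r (s * t))%:MP = (pbr r s)%:MP * t%:MP + s%:MP * (pbr r t)%:MP :> M.
Proof. by rewrite pbr_leibniz mpolyCD !mpolyCM. Qed.
Let XdB u : {morph (fun r => - ((var_der u r)%:MP * 'X_u) : M) : s t / s - t}.
Proof. by move=> s t /=; rewrite var_derB mpolyCB; ring. Qed.
Let XdM u s t : - ((var_der u (s * t))%:MP * 'X_u) =
   - ((var_der u s)%:MP * 'X_u) * t%:MP + s%:MP * - ((var_der u t)%:MP * 'X_u) :> M.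
Proof. by rewrite var_derM mpolyCD !mpolyCM; ring. Qed.

Let poly_pbrCC r s : poly_pbrC r s%:MP = (pbr r s)%:MP.
Proof. exact: (mpoly_derC _ (CdB r)). Qed.
Let poly_pbrCX r v : poly_pbrC r 'X_v = (var_der v r)%:MP * 'X_v.
Proof. exact: (mpoly_derX _ (CdB r) (CdM r)). Qed.
Let poly_pbrXC u r : poly_pbrX u r%:MP = - ((var_der u r)%:MP * 'X_u).
Proof. exact: (mpoly_derC _ (XdB u)). Qed.
Let poly_pbrXX u v : poly_pbrX u 'X_v = pbr_var u v.
Proof. exact: (mpoly_derX _ (XdB u) (XdM u)). Qed.
Let poly_pbrCD r : {morph poly_pbrC r : p q / p + q}.
Proof. exact: (mpoly_derD _ (CdB r)). Qed.
Let poly_pbrXD u : {morph poly_pbrX u : p q / p + q}.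
Proof. exact: (mpoly_derD _ (XdB u)). Qed.
Let poly_pbrCM r p q : poly_pbrC r (p * q) = poly_pbrC r p * q + p * poly_pbrC r q.
Proof. exact: (mpoly_derM _ (CdB r) (CdM r)). Qed.
Let poly_pbrXM u p q : poly_pbrX u (p * q) = poly_pbrX u p * q + p * poly_pbrX u q.
Proof. exact: (mpoly_derM _ (XdB u) (XdM u)). Qed.

Lemma mpoly_gen (P : M -> Prop) :
  (forall p q, P p -> P q -> P (p + q)) ->
  (forall p q, P p -> P q -> P (p * q)) ->
  (forall p, (exists r, p = r%:MP) \/ (exists u, p = 'X_u) -> P p) ->
  forall p, P p.
Proof.
move=> PD PM PG.
have PC r : P r%:MP by apply: PG; left; exists r.
have PX u : P 'X_u by apply: PG; right; exists u.
have P1 : P 1 by rewrite -mpolyC1.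
move=> p; elim/mpolyind: p => [|r m p _ _ Pp]; first by rewrite -mpolyC0.
apply: (PD _ _ _ Pp); rewrite -mul_mpolyC mpolyXE_id; apply: (PM _ _ (PC r)).
apply: (big_ind P P1 PM) => u _; elim: (m u) => [|e IHe]; first by rewrite expr0.
by rewrite exprS; apply: PM.
Qed.

Let poly_pbrC_der_lin p : {morph (fun s => - poly_pbrC s p) : s t / s - t}.
Proof.
move=> s t /=; rewrite /poly_pbrC.
rewrite (eq_mpoly_der (d2 := fun r => 1 * (pbr s r)%:MP + (-1) * (pbr t r)%:MP)
  (h2 := fun v => 1 * ((var_der v s)%:MP * 'X_v) + (-1) * ((var_der v t)%:MP * 'X_v))).
- by rewrite mpoly_der_lin mul1r mulN1r opprD.
- by move=> r; rewrite pbrDl pbrNl mpolyCB; ring.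
- by move=> v; rewrite var_derB mpolyCB; ring.
Qed.
Let poly_pbrC_der_mul p s t :
  - poly_pbrC (s * t) p = - poly_pbrC s p * t%:MP + s%:MP * - poly_pbrC t p.
Proof.
rewrite /poly_pbrC.
rewrite (eq_mpoly_der
  (d2 := fun r => t%:MP * (pbr s r)%:MP + s%:MP * (pbr t r)%:MP)
  (h2 := fun v => t%:MP * ((var_der v s)%:MP * 'X_v)
                  + s%:MP * ((var_der v t)%:MP * 'X_v))).
- by rewrite mpoly_der_lin opprD mulrN mulNr [t%:MP * _]mulrC.
- by move=> r; rewrite pbr_leibnizl mpolyCD !mpolyCM; ring.
- by move=> v; rewrite var_derM mpolyCD !mpolyCM; ring.
Qed.

Lemma poly_pbrpC p s : poly_pbr p s%:MP = - poly_pbrC s p.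
Proof. exact: (mpoly_derC _ (poly_pbrC_der_lin p)). Qed.
Lemma poly_pbrpX p v : poly_pbr p 'X_v = - poly_pbrX v p.
Proof. exact: (mpoly_derX _ (poly_pbrC_der_lin p) (poly_pbrC_der_mul p)). Qed.
Lemma poly_pbrDr p : {morph poly_pbr p : q q' / q + q'}.
Proof. exact: (mpoly_derD _ (poly_pbrC_der_lin p)). Qed.
Lemma poly_pbr_leibniz p q q' :
  poly_pbr p (q * q') = poly_pbr p q * q' + q * poly_pbr p q'.
Proof. exact: (mpoly_derM _ (poly_pbrC_der_lin p) (poly_pbrC_der_mul p)). Qed.
Lemma poly_pbrDl q : {morph poly_pbr^~ q : p p' / p + p'}.
Proof.
move=> p p' /=; rewrite /poly_pbr.
rewrite (eq_mpoly_der (d2 := fun s => 1 * (- poly_pbrC s p) + 1 * (- poly_pbrC s p'))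
  (h2 := fun v => 1 * (- poly_pbrX v p) + 1 * (- poly_pbrX v p'))).
- by rewrite mpoly_der_lin !mul1r.
- by move=> s; rewrite poly_pbrCD !mul1r opprD.
- by move=> s; rewrite poly_pbrXD !mul1r opprD.
Qed.
Lemma poly_pbr_leibnizl p p' q :
  poly_pbr (p * p') q = poly_pbr p q * p' + p * poly_pbr p' q.
Proof.
rewrite /poly_pbr.
rewrite (eq_mpoly_der (d2 := fun s => p' * (- poly_pbrC s p) + p * (- poly_pbrC s p'))
  (h2 := fun v => p' * (- poly_pbrX v p) + p * (- poly_pbrX v p'))).
- by rewrite mpoly_der_lin [p' * _]mulrC.
- by move=> s; rewrite poly_pbrCM opprD !mulrN [p' * _]mulrC.
- by move=> s; rewrite poly_pbrXM opprD !mulrN [p' * _]mulrC.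
Qed.

Lemma poly_pbrCC' r s : poly_pbr r%:MP s%:MP = (pbr r s)%:MP.
Proof. by rewrite poly_pbrpC poly_pbrCC pbrC mpolyCN opprK. Qed.
Lemma poly_pbrCX' r v : poly_pbr r%:MP 'X_v = (var_der v r)%:MP * 'X_v.
Proof. by rewrite poly_pbrpX poly_pbrXC opprK. Qed.
Lemma poly_pbrXC' u r : poly_pbr 'X_u r%:MP = - ((var_der u r)%:MP * 'X_u).
Proof. by rewrite poly_pbrpC poly_pbrCX. Qed.
Lemma poly_pbrXX' u v : poly_pbr 'X_u 'X_v = pbr_var u v.
Proof. by rewrite poly_pbrpX poly_pbrXX pbr_varC opprK. Qed.
Definition poly_pbrE := (poly_pbrCC', poly_pbrCX', poly_pbrXC', poly_pbrXX').

Lemma poly_pbr_anti p q : poly_pbr p q = - poly_pbr q p.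
Proof.
move: p; apply: mpoly_gen => [p p' Hp Hp'|p p' Hp Hp'|p gp].
- by rewrite poly_pbrDl poly_pbrDr Hp Hp' -opprD.
- by rewrite poly_pbr_leibnizl poly_pbr_leibniz Hp Hp' mulNr mulrN -opprD.
move: q; apply: mpoly_gen => [q q' Hq Hq'|q q' Hq Hq'|q gq].
- by rewrite poly_pbrDl poly_pbrDr Hq Hq' -opprD.
- by rewrite poly_pbr_leibnizl poly_pbr_leibniz Hq Hq' mulNr mulrN -opprD.
case: gp gq => -[s ->] [] [t ->]; rewrite !poly_pbrE ?opprK //.
  by rewrite pbrC mpolyCN.
exact: pbr_varC.
Qed.

Let brN p q : poly_pbr p (- q) = - poly_pbr p q.
Proof. exact: (biderN poly_pbrDr). Qed.
Let br0 p : poly_pbr p 0 = 0.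
Proof. exact: (bider0 poly_pbrDr). Qed.

Lemma poly_pbrxx p : poly_pbr p p = 0.
Proof.
move: p; apply: (bider_alt poly_pbrDr poly_pbr_anti poly_pbr_leibniz mpoly_gen).
by move=> p [] [s ->]; rewrite poly_pbrE ?pbrxx ?mpolyC0 ?pbr_varuu.
Qed.

Lemma poly_pbr_scal p c : poly_pbr p (scal c) = 0.
Proof.
move: p; apply: mpoly_gen => [p q Hp Hq|p q Hp Hq|p].
- by rewrite poly_pbrDl Hp Hq addr0.
- by rewrite poly_pbr_leibnizl Hp Hq mul0r mulr0 addr0.
case=> -[s ->]; rewrite /scal poly_pbrE.
  by rewrite pbrZr pbr1r scaler0 mpolyC0.
by rewrite var_der_scal mpolyC0 mul0r oppr0.
Qed.

Lemma pbr_der_a r i : pbr r (∂_ i (a_ i)) = 0.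
Proof.
have : ∂_ i (pbr r (a_ i)) = 0 by rewrite pbrC (td_a_central D) oppr0 td_der0.
rewrite td_der_pbr [pbr (∂_ i r) _]pbrC (td_a_central D) oppr0 add0r.
by [].
Qed.

Lemma poly_pbr_var r u v :
  poly_pbr r%:MP (pbr_var u v) = (var_der u r + var_der v r)%:MP * pbr_var u v.
Proof.
have H (c : k) u' v' : poly_pbr r%:MP (scal c * ('X_u' * 'X_v')) =
    (var_der u' r + var_der v' r)%:MP * (scal c * ('X_u' * 'X_v')).
  by rewrite !poly_pbr_leibniz poly_pbr_scal !poly_pbrE mpolyCD; ring.
have Hyx i j : poly_pbr r%:MP (pbr_yx i j) =
    (var_der (rshift n i) r + var_der (lshift n j) r)%:MP * pbr_yx i j.
  rewrite /pbr_yx; case: eqVneq => [->|ij].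
    by rewrite poly_pbrE pbr_der_a var_derx var_dery addNr mpolyC0 mul0r.
  by rewrite H [var_der _ _ + _]addrC.
case: (split_ordP u) => i ->; case: (split_ordP v) => j ->;
  rewrite ?pbr_varxx ?pbr_varyy ?pbr_varxy ?pbr_varyx.
- by case: eqVneq => [->|ij]; rewrite ?br0 ?mulr0 // H.
- by rewrite brN Hyx mulrN [var_der _ _ + _]addrC.
- exact: Hyx.
- by case: eqVneq => [->|ij]; rewrite ?br0 ?mulr0 // H.
Qed.

Let lamx i j : k := if i == j then 0 else γ i j - μ i j.
Let lamy i j : k := if i == j then 0 else μ j i - γ i j.

Let brxx i j : poly_pbr (x_ i) (x_ j) = scal (lamx i j) * (x_ i * x_ j).
Proof.
rewrite poly_pbrE pbr_varxx /lamx; case: eqVneq => // _.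
by rewrite /scal scale0r mpolyC0 mul0r.
Qed.
Let bryy i j : poly_pbr (y_ i) (y_ j) = scal (lamy i j) * (y_ i * y_ j).
Proof.
rewrite poly_pbrE pbr_varyy /lamy; case: eqVneq => // _.
by rewrite /scal scale0r mpolyC0 mul0r.
Qed.
Let bryx i j : poly_pbr (y_ i) (x_ j) = pbr_yx i j.
Proof. by rewrite poly_pbrE pbr_varyx. Qed.
Let brxy i j : poly_pbr (x_ j) (y_ i) = - pbr_yx i j.
Proof. by rewrite poly_pbr_anti bryx. Qed.

Let lamxC i j : lamx i j = - lamx j i.
Proof.
rewrite /lamx eq_sym; case: eqVneq => [_|ji]; first by rewrite oppr0.
by rewrite gamE 1?eq_sym //; ring.
Qed.
Let lamyC i j : lamy i j = - lamy j i.
Proof.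
rewrite /lamy eq_sym; case: eqVneq => [_|ji]; first by rewrite oppr0.
by rewrite gamE 1?eq_sym //; ring.
Qed.

Local Notation J := (jacobiator poly_pbr).

Let J_xxx i j l : J (x_ i) (x_ j) (x_ l) = 0.
Proof.
rewrite /jacobiator !brxx !poly_pbr_leibniz !poly_pbr_scal !brxx.
by rewrite (lamxC j i) (lamxC l j) (lamxC i l) !scalN; ring.
Qed.

Let J_yyy i j l : J (y_ i) (y_ j) (y_ l) = 0.
Proof.
rewrite /jacobiator !bryy !poly_pbr_leibniz !poly_pbr_scal !bryy.
by rewrite (lamyC j i) (lamyC l j) (lamyC i l) !scalN; ring.
Qed.

Let der_da i j : i != j -> (∂_ j (∂_ i (a_ i)))%:MP = scal (γ i j) * (∂_ i (a_ i))%:MP :> M.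
Proof. by move=> ij; rewrite td_derC td_der_a // td_derZ scalZ. Qed.

Let J_xxy i j l : J (x_ i) (x_ j) (y_ l) = 0.
Proof.
have [<-|ij] := eqVneq i j.
  by rewrite /jacobiator (poly_pbrxx (x_ i)) br0 addr0 (poly_pbr_anti (y_ l)) brN subrr.
wlog lj : i j ij / l != j.
  move=> W; have [lj|lj] := eqVneq l j; last exact: W.
  by rewrite (jacobiator_swap poly_pbrDr poly_pbr_anti) W ?oppr0 // ?lj eq_sym.
rewrite /jacobiator brxy bryx brxx !(poly_pbr_leibniz, brN, poly_pbr_scal, bryx).
rewrite /pbr_yx (negPf lj); case: eqVneq => [li|li].
  rewrite !li !poly_pbrE !(poly_pbr_leibniz, poly_pbr_scal) !poly_pbrE.
  rewrite var_derx der_da // pbr_varxx !pbr_varxy /pbr_yx eqxx (negPf ij).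
  by rewrite /lamx (negPf ij) !(scalD, scalN); ring.
rewrite !(poly_pbr_leibniz, poly_pbr_scal) !brxx !brxy /pbr_yx (negPf li) (negPf lj).
by rewrite (lamxC j i) scalN; ring.
Qed.

Let J_yyx i j l : J (y_ i) (y_ j) (x_ l) = 0.
Proof.
have [<-|ij] := eqVneq i j.
  by rewrite /jacobiator (poly_pbrxx (y_ i)) br0 addr0 (poly_pbr_anti (x_ l)) brN subrr.
wlog jl : i j ij / j != l.
  move=> W; have [jl|jl] := eqVneq j l; last exact: W.
  by rewrite (jacobiator_swap poly_pbrDr poly_pbr_anti) W ?oppr0 -?jl // eq_sym.
rewrite /jacobiator brxy bryx bryy !(poly_pbr_leibniz, brN, poly_pbr_scal, brxy).
rewrite /pbr_yx (negPf jl); case: eqVneq => [il|il].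
  rewrite -!il !poly_pbrE !(poly_pbr_leibniz, poly_pbr_scal) !poly_pbrE.
  rewrite var_dery mpolyCN der_da // pbr_varyy !pbr_varyx /pbr_yx eqxx.
  by rewrite /lamy (negPf ij) !(scalD, scalN); ring.
rewrite !(poly_pbr_leibniz, poly_pbr_scal) !bryy !bryx /pbr_yx (negPf il) (negPf jl).
by rewrite (lamyC j i) scalN; ring.
Qed.

Lemma poly_pbr_jacobi p q t :
  poly_pbr p (poly_pbr q t) + poly_pbr q (poly_pbr t p)
    + poly_pbr t (poly_pbr p q) = 0.
Proof.
move: p q t.
apply: (bider_jacobi poly_pbrDr poly_pbr_anti poly_pbr_leibniz mpoly_gen).
have Jrrr r s t : J r%:MP s%:MP t%:MP = 0.
  by rewrite /jacobiator !poly_pbrE -!mpolyCD pbr_jacobi mpolyC0.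
have Jrru r s u : J r%:MP s%:MP 'X_u = 0.
  rewrite /jacobiator !(poly_pbrE, brN, poly_pbr_leibniz) var_der_pbr.
  by rewrite [pbr (var_der u r) s]pbrC mpolyCD mpolyCN; ring.
have Jruv r u v : J r%:MP 'X_u 'X_v = 0.
  rewrite /jacobiator !poly_pbrE poly_pbr_var.
  rewrite !(poly_pbrE, brN, poly_pbr_leibniz) var_der_comm.
  by rewrite [pbr_var v u]pbr_varC mpolyCD; ring.
have Juvw u v w : J 'X_u 'X_v 'X_w = 0.
  case: (split_ordP u) => i ->; case: (split_ordP v) => j ->;
    case: (split_ordP w) => l ->.
  - exact: J_xxx.
  - exact: J_xxy.
  - by rewrite -jacobiatorC J_xxy.
  - by rewrite jacobiatorC J_yyx.
  - by rewrite jacobiatorC J_xxy.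
  - by rewrite -jacobiatorC J_yyx.
  - exact: J_yyx.
  - exact: J_yyy.
move=> p q t [] [r ->] [] [s ->] [] [w ->] //.
- by rewrite -jacobiatorC.
- by rewrite jacobiatorC.
- by rewrite jacobiatorC.
- by rewrite -jacobiatorC.
Qed.

(* The ideal (y_1 x_1 - a_1, ..., y_n x_n - a_n). *)
Definition tgwpa_rel i : M := y_ i * x_ i - (a_ i)%:MP.

Definition tgwpa_ideal p : bool :=
  `[< exists q : 'I_n -> M, p = \sum_(i < n) q i * tgwpa_rel i >].

Lemma tgwpa_ideal_closed : idealr_closed tgwpa_ideal.
Proof.
split.
- apply/asboolP; exists (fun=> 0); rewrite big1 // => i _; exact: mul0r.
- apply/negP => /asboolP[q].
  pose ev p : R := p.@[fun u => match split u with inl _ => 1 | inr i => a_ i end].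
  have ev0 i : ev (tgwpa_rel i) = 0.
    rewrite /ev /tgwpa_rel mevalB mevalM !mevalXU mevalC.
    rewrite -[lshift n i]/(unsplit (inl i)) -[rshift n i]/(unsplit (inr i)) !unsplitK.
    by rewrite mulr1 subrr.
  move=> /(congr1 ev); rewrite /ev meval1 raddf_sum big1 => [/eqP|i _].
    by rewrite oner_eq0.
  by rewrite [LHS]mevalM [X in _ * X]ev0 mulr0.
- move=> p q q' /asboolP[f ->] /asboolP[f' ->]; apply/asboolP.
  exists (fun i => p * f i + f' i); rewrite mulr_sumr -big_split /=.
  by apply: eq_bigr => i _; rewrite mulrDl mulrA.
Qed.

HB.instance Definition _ := isIdealr.Build M tgwpa_ideal tgwpa_ideal_closed.

Definition tgwpa : Type := {ideal_quot (Idealr.clone M tgwpa_ideal _)}.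
HB.instance Definition _ := GRing.ComNzRing.on tgwpa.
HB.instance Definition _ := Quotient.on tgwpa.

Definition tgwpa_pi p : tgwpa := \pi_tgwpa p.

Lemma tgwpa_piP p q : tgwpa_pi p = tgwpa_pi q <->
  exists f : 'I_n -> M, p - q = \sum_(i < n) f i * tgwpa_rel i.
Proof.
split=> [/eqP|H]; last apply/eqP.
  by rewrite -Quotient.idealrBE => /asboolP.
by rewrite -Quotient.idealrBE; apply/asboolP.
Qed.

Lemma tgwpa_piD : {morph tgwpa_pi : p q / p + q}.
Proof. exact: Quotient.pi_add. Qed.
Lemma tgwpa_piM : {morph tgwpa_pi : p q / p * q}.
Proof. exact: Quotient.pi_mul. Qed.
Lemma tgwpa_pi1 : tgwpa_pi 1 = 1.
Proof. by rewrite /GRing.one /=; unlock Quotient.one. Qed.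
Lemma tgwpa_pi0 : tgwpa_pi 0 = 0.
Proof. by apply: (addrI (tgwpa_pi 0)); rewrite -tgwpa_piD !addr0. Qed.
Lemma tgwpa_piN : {morph tgwpa_pi : p / - p}.
Proof.
by move=> p; apply: (addrI (tgwpa_pi p)); rewrite -tgwpa_piD !subrr tgwpa_pi0.
Qed.
Lemma tgwpa_reprK (z : tgwpa) : tgwpa_pi (repr z) = z.
Proof. exact: reprK. Qed.

Definition tgwpa_scale (c : k) (z : tgwpa) : tgwpa := tgwpa_pi (scal c) * z.

Lemma tgwpa_scaleA b c z :
  tgwpa_scale b (tgwpa_scale c z) = tgwpa_scale (b * c) z.
Proof. by rewrite /tgwpa_scale mulrA scalM tgwpa_piM. Qed.
Lemma tgwpa_scale1 : left_id 1 tgwpa_scale.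
Proof. by move=> z; rewrite /tgwpa_scale scal1 tgwpa_pi1 mul1r. Qed.
Lemma tgwpa_scaleDr : right_distributive tgwpa_scale +%R.
Proof. by move=> c z z'; rewrite /tgwpa_scale mulrDr. Qed.
Lemma tgwpa_scaleDl z : {morph tgwpa_scale^~ z : b c / b + c}.
Proof. by move=> b c; rewrite /tgwpa_scale scalD tgwpa_piD mulrDl. Qed.

HB.instance Definition _ := GRing.Zmodule_isLmodule.Build k tgwpa
  tgwpa_scaleA tgwpa_scale1 tgwpa_scaleDr tgwpa_scaleDl.

Lemma tgwpa_scalerAl (c : k) (z z' : tgwpa) : c *: (z * z') = (c *: z) * z'.
Proof. exact: mulrA. Qed.

HB.instance Definition _ :=
  GRing.Lmodule_isLalgebra.Build k tgwpa tgwpa_scalerAl.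
HB.instance Definition _ := GRing.Lalgebra_isComAlgebra.Build k tgwpa.

Lemma tgwpa_scaleE c (z : tgwpa) : c *: z = tgwpa_pi (scal c) * z.
Proof. by []. Qed.

Lemma poly_pbr_rel p i : exists q, poly_pbr p (tgwpa_rel i) = q * tgwpa_rel i.
Proof.
move: p; apply: mpoly_gen => [p q [f Hp] [g Hq]|p q [f Hp] [g Hq]|p].
- by exists (f + g); rewrite poly_pbrDl Hp Hq mulrDl.
- by exists (f * q + p * g); rewrite poly_pbr_leibnizl Hp Hq; ring.
rewrite /tgwpa_rel; case=> -[u ->].
  exists 0; rewrite poly_pbrDr brN poly_pbr_leibniz !poly_pbrE var_derx var_dery.
  by rewrite [pbr u _]pbrC (td_a_central D) oppr0 mpolyC0 mpolyCN; ring.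
rewrite poly_pbrDr brN poly_pbr_leibniz poly_pbrXC'.
case: (split_ordP u) => j ->.
  rewrite brxx brxy var_derx /pbr_yx /lamx ![j == i]eq_sym.
  case: eqVneq => [<-|ij].
    by exists 0; rewrite /scal scale0r mpolyC0; ring.
  exists (- (scal (γ i j) * x_ j)).
  have -> : γ j i - μ j i = μ i j - γ i j.
    by rewrite (gamE ij); ring.
  by rewrite td_der_a // scalZ !(scalD, scalN); ring.
rewrite bryy bryx var_dery /pbr_yx /lamy.
case: eqVneq => [->|ji].
  by exists 0; rewrite /scal scale0r mpolyC0 mpolyCN; ring.
have ij : i != j by rewrite eq_sym.
exists (scal (γ i j) * y_ j).
have -> : μ i j - γ j i = γ i j - μ j i.
  by rewrite (gamE ij); ring.
by rewrite td_der_a // mpolyCN scalZ !(scalD, scalN); ring.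
Qed.

Lemma poly_pbr_wdr p q q' : tgwpa_pi q = tgwpa_pi q' ->
  tgwpa_pi (poly_pbr p q) = tgwpa_pi (poly_pbr p q').
Proof.
move=> /tgwpa_piP[f Hf]; have /choice[g Hg] := poly_pbr_rel p.
apply/tgwpa_piP; exists (fun i => poly_pbr p (f i) + f i * g i).
rewrite -brN -poly_pbrDr Hf (big_morph _ (poly_pbrDr p) (br0 p)).
by apply: eq_bigr => i _; rewrite poly_pbr_leibniz Hg; ring.
Qed.

Lemma poly_pbr_wd p p' q q' : tgwpa_pi p = tgwpa_pi p' ->
  tgwpa_pi q = tgwpa_pi q' ->
  tgwpa_pi (poly_pbr p q) = tgwpa_pi (poly_pbr p' q').
Proof.
move=> Hp Hq; rewrite (poly_pbr_wdr p Hq) [poly_pbr p _]poly_pbr_anti.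
rewrite [poly_pbr p' _]poly_pbr_anti !tgwpa_piN; congr (- _).
exact: poly_pbr_wdr.
Qed.

Definition tgwpa_pbr (z z' : tgwpa) : tgwpa :=
  tgwpa_pi (poly_pbr (repr z) (repr z')).

Lemma tgwpa_pbrE p q : tgwpa_pbr (tgwpa_pi p) (tgwpa_pi q) = tgwpa_pi (poly_pbr p q).
Proof. by apply: poly_pbr_wd; rewrite tgwpa_reprK. Qed.

Lemma tgwpa_pbr_linearr z : linear (tgwpa_pbr z).
Proof.
move=> c z1 z2; rewrite !tgwpa_scaleE.
rewrite -[z]tgwpa_reprK -[z1]tgwpa_reprK -[z2]tgwpa_reprK.
rewrite -tgwpa_piM -tgwpa_piD !tgwpa_pbrE -tgwpa_piM -tgwpa_piD.
by rewrite poly_pbrDr poly_pbr_leibniz poly_pbr_scal mul0r add0r.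
Qed.

Lemma tgwpa_pbrC z z' : tgwpa_pbr z z' = - tgwpa_pbr z' z.
Proof.
rewrite -[z]tgwpa_reprK -[z']tgwpa_reprK !tgwpa_pbrE -tgwpa_piN.
by rewrite [in LHS]poly_pbr_anti.
Qed.

Lemma tgwpa_pbr_linearl z : linear (tgwpa_pbr^~ z).
Proof.
move=> c z1 z2 /=; rewrite ![tgwpa_pbr _ z]tgwpa_pbrC tgwpa_pbr_linearr.
by rewrite opprD scalerN.
Qed.

Lemma tgwpa_pbrxx z : tgwpa_pbr z z = 0.
Proof. by rewrite -[z]tgwpa_reprK tgwpa_pbrE poly_pbrxx tgwpa_pi0. Qed.

Lemma tgwpa_pbr_jacobi z1 z2 z3 :
  tgwpa_pbr z1 (tgwpa_pbr z2 z3) + tgwpa_pbr z2 (tgwpa_pbr z3 z1)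
    + tgwpa_pbr z3 (tgwpa_pbr z1 z2) = 0.
Proof.
rewrite -[z1]tgwpa_reprK -[z2]tgwpa_reprK -[z3]tgwpa_reprK !tgwpa_pbrE.
by rewrite -!tgwpa_piD poly_pbr_jacobi tgwpa_pi0.
Qed.

Lemma tgwpa_pbr_leibniz z1 z2 z3 :
  tgwpa_pbr z1 (z2 * z3) = tgwpa_pbr z1 z2 * z3 + z2 * tgwpa_pbr z1 z3.
Proof.
rewrite -[z1]tgwpa_reprK -[z2]tgwpa_reprK -[z3]tgwpa_reprK.
by rewrite -tgwpa_piM !tgwpa_pbrE poly_pbr_leibniz tgwpa_piD !tgwpa_piM.
Qed.

HB.instance Definition _ := isPoisson.Build k tgwpa tgwpa_pbr_linearl
  tgwpa_pbr_linearr tgwpa_pbrxx tgwpa_pbr_jacobi tgwpa_pbr_leibniz.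

Definition tgwpa_in r : tgwpa := tgwpa_pi r%:MP.
Definition tgwpa_x i : tgwpa := tgwpa_pi (x_ i).
Definition tgwpa_y i : tgwpa := tgwpa_pi (y_ i).

Lemma tgwpa_yx i : tgwpa_y i * tgwpa_x i = tgwpa_in (a_ i).
Proof.
rewrite -tgwpa_piM; apply/tgwpa_piP; exists (fun j => (j == i)%:R).
rewrite (bigD1 i) //= eqxx mul1r big1 ?addr0 // => j /negPf ->.
by rewrite mul0r.
Qed.

Lemma tgwpa_pbr_in r s : pbr (tgwpa_in r) (tgwpa_in s) = tgwpa_in (pbr r s).
Proof. by rewrite [LHS]tgwpa_pbrE poly_pbrE. Qed.

Lemma tgwpa_pbr_in_x r i :
  pbr (tgwpa_in r) (tgwpa_x i) = tgwpa_in (∂_ i r) * tgwpa_x i.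
Proof. by rewrite [LHS]tgwpa_pbrE poly_pbrE var_derx tgwpa_piM. Qed.

Lemma tgwpa_pbr_in_y r i :
  pbr (tgwpa_in r) (tgwpa_y i) = - (tgwpa_in (∂_ i r) * tgwpa_y i).
Proof.
by rewrite [LHS]tgwpa_pbrE poly_pbrE var_dery mpolyCN mulNr tgwpa_piN tgwpa_piM.
Qed.

Lemma tgwpa_pbr_y_x i : pbr (tgwpa_y i) (tgwpa_x i) = tgwpa_in (∂_ i (a_ i)).
Proof. by rewrite [LHS]tgwpa_pbrE bryx /pbr_yx eqxx. Qed.

Lemma tgwpa_pbr_y_x_neq i j : i != j ->
  pbr (tgwpa_y i) (tgwpa_x j) = μ i j *: (tgwpa_x j * tgwpa_y i).
Proof.
by move=> ij; rewrite [LHS]tgwpa_pbrE bryx /pbr_yx (negPf ij) !tgwpa_piM.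
Qed.

Lemma tgwpa_pbr_x_x i j : i != j ->
  pbr (tgwpa_x i) (tgwpa_x j) = (γ i j - μ i j) *: (tgwpa_x i * tgwpa_x j).
Proof.
by move=> ij; rewrite [LHS]tgwpa_pbrE brxx /lamx (negPf ij) !tgwpa_piM.
Qed.

Lemma tgwpa_pbr_y_y i j : i != j ->
  pbr (tgwpa_y i) (tgwpa_y j) = (μ j i - γ i j) *: (tgwpa_y i * tgwpa_y j).
Proof.
by move=> ij; rewrite [LHS]tgwpa_pbrE bryy /lamy (negPf ij) !tgwpa_piM.
Qed.

End TGWPA.

(* E is the datum (R ⊗ R', nabla, b, mu ⊕ mu').  Its gamma is not prescribed:
   off the diagonal it is determined by nabla and b. *)
Definition tensor_datum (k : fieldType) (R R' : poissonAlgType k) (n m : nat)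
    (D : tgwpa_datum R n) (D' : tgwpa_datum R' m)
    (E : tgwpa_datum (tensor R R') (n + m)) : Prop :=
  [/\ td_mu E = block_mx (td_mu D) 0 0 (td_mu D'),
      forall i : 'I_n, td_der E (lshift m i) =1 tensor_map (td_der D i) idfun,
      forall j : 'I_m, td_der E (rshift n j) =1 tensor_map idfun (td_der D' j),
      forall i : 'I_n, td_a E (lshift m i) = td_a D i ⊗ 1
    & forall j : 'I_m, td_a E (rshift n j) = 1 ⊗ td_a D' j].

(* Main.v *)
(** Both algebras satisfy the universal property of the same generators and
    relations, which gives mutually inverse algebra morphisms; since brackets are
    biderivations, compatibility with them is checked on generators.  The scalars
    gamma of the datum on [R ⊗ R'] are forced, because its elements [b_i] are
    regular: they agree with those of the two factors and vanish across them.

    The existence of the datum rests on the regularity of [a ⊗ 1] and [1 ⊗ a'],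
    i.e. on the flatness of vector spaces. *)

Require Import Defs.
From HB Require Import structures.
From mathcomp Require Import all_boot all_order all_algebra.
From mathcomp Require Import mpoly ring.
Import GRing.Theory.
Local Open Scope ring_scope.

Set Implicit Arguments.
Unset Strict Implicit.
Unset Printing Implicit Defensive.

(** * Contractions separate tensors over a field; flatness *)

Section TensorSeparation.
Variables (k : fieldType) (B C : lmodType k).
Implicit Types x : tensor B C.

Lemma tensor_sum x : exists s : seq (B * C), x = \sum_(p <- s) p.1 ⊗ p.2.
Proof.
elim/tensor_ind: x => [x y [s ->] [t ->]|b c].
  by exists (s ++ t); rewrite big_cat.
by exists [:: (b, c)]; rewrite big_seq1.
Qed.

(** The linear map induced on [tensor B C] is contraction of the right factor with [psi]; such
    contractions detect nonzero tensors. *)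
Lemma slice_bilinear (psi : {linear C -> k^o}) :
  bilinear_map (fun b c => psi c *: b : B).
Proof.
split=> [c a b b'|b a c c'] /=; first by rewrite scalerDr !scalerA mulrC.
by rewrite linearP scalerDl scalerA.
Qed.

(* If [beta x != 0], some term [b ⊗ c] of a decomposition of [x] has
   [beta (b ⊗ c) != 0].  Slicing [x] with [beta (b ⊗ -)] then either gives a
   nonzero vector or expresses [b] through the other terms, and [x] has a
   shorter decomposition. *)
Lemma tensor_separation x : x != 0 ->
  exists psi : {linear C -> k^o}, tlift (fun b c => psi c *: b) x != 0.
Proof.
move=> x0; have [beta betaL beta1] := linear_functional_exists x0.
have [s xs] := tensor_sum x.
have [N sN] := ubnP (size s); elim: N => // N IHN in s xs sN *.
pose F : {linear tensor B C -> k^o} :=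
  HB.pack beta (GRing.isLinear.Build k (tensor B C) k^o *:%R beta betaL).
have [/hasP[p ps Fp]|/hasPn Fs] := boolP (has (fun p => F (p.1 ⊗ p.2) != 0) s);
  last first.
  have : F x = 0.
    by rewrite xs linear_sum big_seq big1 // => p /Fs /negPn/eqP.
  by move/eqP; rewrite [F x]beta1 oner_eq0.
have psiL : linear (fun c => F (p.1 ⊗ c)).
  by move=> a c c'; rewrite tensor_linearr linearP.
pose psi : {linear C -> k^o} :=
  HB.pack (fun c => F (p.1 ⊗ c)) (GRing.isLinear.Build _ _ _ _ _ psiL).
have [slice0|] := eqVneq (tlift (fun b c => psi c *: b) x) 0; last by exists psi.
have psB := slice_bilinear psi.
pose L : {linear tensor B C -> B} :=
  HB.pack (tlift (fun b c => psi c *: b)) (GRing.isLinear.Build _ _ _ _ _ (tlift_linear psB)).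
have xrem : x = p.1 ⊗ p.2 + \sum_(q <- rem p s) q.1 ⊗ q.2.
  by rewrite xs (big_rem p).
have Lx0 : L x = 0 := slice0.
have := Lx0; rewrite {1}xrem linearD linear_sum [L (p.1 ⊗ _)](tliftE _ _ psB) => /eqP.
rewrite addr_eq0 => /eqP p1E {Lx0}.
(* Since [psi p.2 = F (p.1 ⊗ p.2)] is nonzero, the vanishing of the slice can be solved for
   [p.1]. *)
have {}p1E : p.1 = - (psi p.2)^-1 *: \sum_(q <- rem p s) psi q.2 *: q.1.
  apply: (scalerI Fp); rewrite -[F _]/(psi p.2) p1E scalerA mulrN mulfV // scaleN1r.
  by congr (- _); apply: eq_bigr => q _; rewrite [LHS](tliftE _ _ psB).
(* Substituting for [p.1] absorbs [p.1 ⊗ p.2] into the right factors of the remaining terms, which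
   leaves one term less. *)
apply: (IHN [seq (q.1, q.2 - ((psi p.2)^-1 * psi q.2) *: p.2) | q <- rem p s]).
  rewrite big_map xrem {1}p1E tensorZl.
  rewrite (big_morph (fun b => b ⊗ p.2) (fun b b' => tensorDl b b' p.2) (tensor0l _ _)).
  rewrite scaler_sumr -big_split; apply: eq_bigr => q _ /=.
  by rewrite tensorDr tensorNr tensorZl tensorZr scalerA mulNr scaleNr addrC.
rewrite size_map size_rem // -ltnS prednK //.
by case: (s) ps.
Qed.

End TensorSeparation.

Lemma tensor_map_linear (k : fieldType) (B B' C C' : lmodType k)
    (f : B -> B') (g : C -> C') :
  linear f -> linear g -> linear (tensor_map f g).
Proof.
move=> fL gL; apply: tlift_linear.
by split=> [c a b b'|b a c c'] /=; rewrite ?fL ?gL (tensor_linearl, tensor_linearr).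
Qed.

(** This is flatness of [C]: a nonzero [x] has a nonzero contraction in [B], which [f] keeps
    nonzero. Contraction commutes with [f ⊗ id], so the image of [x] cannot vanish. *)
Lemma tensor_map_injl (k : fieldType) (B B' C : lmodType k)
    (f : {linear B -> B'}) :
  injective f -> injective (tensor_map f (idfun : C -> C)).
Proof.
move=> finj.
have TL : linear (tensor_map f (idfun : C -> C)).
  by apply: tensor_map_linear => //; apply: linearP.
pose T : {linear tensor B C -> tensor B' C} :=
  HB.pack (tensor_map f idfun) (GRing.isLinear.Build _ _ _ _ _ TL).
apply: (@raddf_inj _ _ T) => x Tx0; apply/eqP; apply: contraT => /tensor_separation[psi].
rewrite -(inj_eq finj) raddf0.
have psB := slice_bilinear B psi; have psB' := slice_bilinear B' psi.
pose L : {linear tensor B C -> B} :=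
  HB.pack (tlift _) (GRing.isLinear.Build _ _ _ _ _ (tlift_linear psB)).
pose L' : {linear tensor B' C -> B'} :=
  HB.pack (tlift _) (GRing.isLinear.Build _ _ _ _ _ (tlift_linear psB')).
suff -> : f (tlift (fun b c => psi c *: b) x) = L' (T x) by rewrite Tx0 raddf0 eqxx.
rewrite -[tlift _ x]/(L x).
elim/tensor_ind: x {Tx0} => [x y Hx Hy|b c]; first by rewrite !linearD /= Hx Hy.
rewrite [T _]tensor_mapE //; last exact: linearP.
by rewrite [L _](tliftE _ _ psB) [RHS](tliftE _ _ psB') linearZ.
Qed.

(** * The tensor product as coproduct of commutative algebras; regular elements *)

Section TensorMorphisms.
Variables (k : fieldType) (B C : comAlgType k).

(** The two coproduct inclusions, named so that they can carry linear and multiplicative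
    structures. *)
Definition tensor_inl (b : B) : tensor B C := b ⊗ 1.
Definition tensor_inr (c : C) : tensor B C := 1 ⊗ c.

Lemma tensor_inl_linear : linear tensor_inl.
Proof. exact: tensor_linearl. Qed.
Lemma tensor_inl_monoid_morphism : monoid_morphism tensor_inl.
Proof. by split=> // b b'; rewrite /tensor_inl tensorM mulr1. Qed.
HB.instance Definition _ :=
  GRing.isLinear.Build k B (tensor B C) *:%R tensor_inl tensor_inl_linear.
HB.instance Definition _ := GRing.isMonoidMorphism.Build B (tensor B C)
  tensor_inl tensor_inl_monoid_morphism.

Lemma tensor_inr_linear : linear tensor_inr.
Proof. exact: tensor_linearr. Qed.
Lemma tensor_inr_monoid_morphism : monoid_morphism tensor_inr.
Proof. by split=> // c c'; rewrite /tensor_inr tensorM mulr1. Qed.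
HB.instance Definition _ :=
  GRing.isLinear.Build k C (tensor B C) *:%R tensor_inr tensor_inr_linear.
HB.instance Definition _ := GRing.isMonoidMorphism.Build C (tensor B C)
  tensor_inr tensor_inr_monoid_morphism.

Lemma tensor_inM b c : b ⊗ c = tensor_inl b * tensor_inr c.
Proof. by rewrite tensorM mulr1 mul1r. Qed.

Section Lift.
Variables (P : comAlgType k) (u : {lrmorphism B -> P}) (v : {lrmorphism C -> P}).

(** The copairing of [u] and [v]; it is multiplicative because [P] is commutative. *)
Definition tensor_lift : tensor B C -> P := tlift (fun b c => u b * v c).

Let lift_bilinear : bilinear_map (fun b c => u b * v c).
Proof.
split=> [c a b b'|b a c c'] /=; rewrite linearP ?mulrDl ?mulrDr.
  by rewrite scalerAl.
by rewrite scalerAr.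
Qed.

Lemma tensor_liftE b c : tensor_lift (b ⊗ c) = u b * v c.
Proof. exact: tliftE. Qed.

Lemma tensor_lift_linear : linear tensor_lift.
Proof. exact: tlift_linear. Qed.
HB.instance Definition _ :=
  GRing.isLinear.Build k (tensor B C) P *:%R tensor_lift tensor_lift_linear.

Lemma tensor_lift_monoid_morphism : monoid_morphism tensor_lift.
Proof.
split=> [|x y]; first by rewrite tensor1 tensor_liftE !rmorph1 mulr1.
elim/tensor_ind: x => [x x' Hx Hx'|b c]; first by rewrite mulrDl !linearD /= Hx Hx' mulrDl.
elim/tensor_ind: y => [y y' Hy Hy'|b' c']; first by rewrite mulrDr !linearD /= Hy Hy' mulrDr.
by rewrite tensorM !tensor_liftE !rmorphM mulrACA.
Qed.
HB.instance Definition _ := GRing.isMonoidMorphism.Build (tensor B C) P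
  tensor_lift tensor_lift_monoid_morphism.

Lemma tensor_lift_inl b : tensor_lift (tensor_inl b) = u b.
Proof. by rewrite tensor_liftE rmorph1 mulr1. Qed.
Lemma tensor_lift_inr c : tensor_lift (tensor_inr c) = v c.
Proof. by rewrite tensor_liftE rmorph1 mul1r. Qed.

End Lift.

Lemma tensor_alg_eq (P : comAlgType k) (f g : {lrmorphism tensor B C -> P}) :
  (forall b, f (tensor_inl b) = g (tensor_inl b)) ->
  (forall c, f (tensor_inr c) = g (tensor_inr c)) -> f =1 g.
Proof.
move=> fgl fgr; elim/tensor_ind=> [x y Hx Hy|b c]; first by rewrite !linearD /= Hx Hy.
by rewrite tensor_inM !rmorphM /= fgl fgr.
Qed.

(** Multiplication by [b ⊗ 1] is multiplication by [b] tensored with the identity of [C], hence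
    injective by flatness. *)
Lemma tensor_inl_lreg b : GRing.lreg b -> GRing.lreg (tensor_inl b).
Proof.
move=> breg; pose f : {linear B -> B} := b \*o (idfun : B -> B).
have fL : linear (tensor_map f (idfun : C -> C)).
  by apply: tensor_map_linear => //; apply: linearP.
have fE x : tensor_map f (idfun : C -> C) x = tensor_inl b * x.
  elim/tensor_ind: x => [x y Hx Hy|b' c].
    by have := fL 1 x y; rewrite !scale1r Hx Hy mulrDr.
  rewrite tensor_mapE //; last exact: linearP.
  by rewrite tensorM mul1r.
have finj : injective f by [].
by move=> x y; rewrite -!fE; apply: tensor_map_injl finj _ _.
Qed.

End TensorMorphisms.

(** The flip of the two factors is an injective algebra morphism that takes [1 ⊗ c] to [c ⊗ 1], so
    the left-hand case applies. *)
Lemma tensor_inr_lreg (k : fieldType) (B C : comAlgType k) (c : C) :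
  GRing.lreg c -> GRing.lreg (tensor_inr B c).
Proof.
move=> /(@tensor_inl_lreg _ _ B) creg.
pose swap (B C : comAlgType k) : {lrmorphism tensor B C -> tensor C B} :=
  tensor_lift (@tensor_inr k C B) (@tensor_inl k C B).
have swapK : cancel (swap B C) (swap C B).
  move=> x; apply: (tensor_alg_eq (f := swap C B \o swap B C) (g := idfun)) => [b|d] /=.
    by rewrite /swap tensor_lift_inl tensor_lift_inr.
  by rewrite /swap tensor_lift_inr tensor_lift_inl.
move=> x y /(congr1 (swap B C)); rewrite !rmorphM /= tensor_lift_inr.
by move=> /creg /(can_inj swapK).
Qed.

(** * Poisson morphisms checked on generators *)

(** With one argument fixed, compatibility with the bracket is stable under sums and products of the
    other, because both brackets are biderivations. Induction runs over one argument and then the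
    other. *)
Lemma poisson_morph_gen (k : fieldType) (A B : poissonAlgType k) (G : A -> Prop)
    (f : {lrmorphism A -> B}) :
  (forall P : A -> Prop,
     (forall x y, P x -> P y -> P (x + y)) ->
     (forall x y, P x -> P y -> P (x * y)) ->
     (forall x, G x -> P x) -> forall x, P x) ->
  (forall x y, G x -> G y -> f (pbr x y) = pbr (f x) (f y)) ->
  poisson_morph f.
Proof.
move=> genG fG x y; move: x; apply: (genG) => [x x' Hx Hx'|x x' Hx Hx'|x Gx].
- by rewrite pbrDl !linearD /= Hx Hx' pbrDl.
- by rewrite pbr_leibnizl linearD !rmorphM /= Hx Hx' pbr_leibnizl.
move: y; apply: (genG) => [y y' Hy Hy'|y y' Hy Hy'|y Gy]; last exact: fG.
- by rewrite pbrDr !linearD /= Hy Hy' pbrDr.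
- by rewrite pbr_leibniz linearD !rmorphM /= Hy Hy' pbr_leibniz.
Qed.

Lemma poisson_morph_inl (k : fieldType) (B C : poissonAlgType k) :
  poisson_morph (@tensor_inl k B C).
Proof. by move=> b b'; rewrite pbr_tensor pbr1r tensor0r addr0 mulr1. Qed.

Lemma poisson_morph_inr (k : fieldType) (B C : poissonAlgType k) :
  poisson_morph (@tensor_inr k B C).
Proof. by move=> c c'; rewrite pbr_tensor pbr1r tensor0l add0r mulr1. Qed.

Lemma pbr_inl_inr (k : fieldType) (B C : poissonAlgType k) (b : B) (c : C) :
  pbr (tensor_inl C b) (tensor_inr B c) = 0.
Proof. by rewrite pbr_tensor pbr1r pbr1l tensor0r tensor0l addr0. Qed.

(** Expanding the bracket of [u b * v c] and [u b' * v c'] by Leibniz gives four terms. The two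
    mixed ones vanish, and the others are the images of the two summands of the tensor bracket. *)
Lemma tensor_lift_poisson (k : fieldType) (B C P : poissonAlgType k)
    (u : {lrmorphism B -> P}) (v : {lrmorphism C -> P}) :
  poisson_morph u -> poisson_morph v -> (forall b c, pbr (u b) (v c) = 0) ->
  poisson_morph (tensor_lift u v).
Proof.
move=> up vp uv x y; elim/tensor_ind: x => [x x' Hx Hx'|b c].
  by rewrite pbrDl !linearD /= Hx Hx' pbrDl.
elim/tensor_ind: y => [y y' Hy Hy'|b' c'].
  by rewrite pbrDr !linearD /= Hy Hy' pbrDr.
rewrite pbr_tensor linearD /= !tensor_liftE !rmorphM up vp.
rewrite !(pbr_leibniz, pbr_leibnizl) uv [pbr (v c) (u b')]pbrC uv; ring.
Qed.

(** * The universal property of a TGWPA as a commutative algebra *)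

Section TGWPALift.
Variables (k : fieldType) (R : poissonAlgType k) (n : nat).
Variable D : tgwpa_datum R n.
Local Notation M := {mpoly R[n + n]}.

Lemma tgwpa_in_linear : linear (tgwpa_in D).
Proof.
by move=> c r s; rewrite tgwpa_scaleE -tgwpa_piM -tgwpa_piD -scalZ -mpolyCD.
Qed.
Lemma tgwpa_in_monoid_morphism : monoid_morphism (tgwpa_in D).
Proof.
split=> [|r s]; first by rewrite /tgwpa_in mpolyC1 tgwpa_pi1.
by rewrite /tgwpa_in mpolyCM tgwpa_piM.
Qed.
HB.instance Definition _ :=
  GRing.isLinear.Build k R (tgwpa D) *:%R (tgwpa_in D) tgwpa_in_linear.
HB.instance Definition _ := GRing.isMonoidMorphism.Build R (tgwpa D)
  (tgwpa_in D) tgwpa_in_monoid_morphism.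

(** The whole image of [R] is included, and with it all scalars, so that sums and products suffice
    in [tgwpa_gen]. *)
Definition tgwpa_generator (z : tgwpa D) : Prop :=
  [\/ exists r, z = tgwpa_in D r, exists i, z = tgwpa_x D i
    | exists i, z = tgwpa_y D i].

Lemma tgwpa_gen (P : tgwpa D -> Prop) :
  (forall z w, P z -> P w -> P (z + w)) ->
  (forall z w, P z -> P w -> P (z * w)) ->
  (forall z, tgwpa_generator z -> P z) -> forall z, P z.
Proof.
move=> PD PM PG z; rewrite -[z]tgwpa_reprK; move: (repr z).
apply: mpoly_gen => [p q Hp Hq|p q Hp Hq|p].
- by rewrite tgwpa_piD; apply: PD.
- by rewrite tgwpa_piM; apply: PM.
case=> [[r ->]|[u ->]]; first by apply/PG/Or31; exists r.
by case: (split_ordP u) => i ->; apply: PG; [apply: Or32|apply: Or33]; exists i.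
Qed.

Lemma tgwpa_alg_eq (B : comAlgType k) (f g : {lrmorphism tgwpa D -> B}) :
  (forall r, f (tgwpa_in D r) = g (tgwpa_in D r)) ->
  (forall i, f (tgwpa_x D i) = g (tgwpa_x D i)) ->
  (forall i, f (tgwpa_y D i) = g (tgwpa_y D i)) -> f =1 g.
Proof.
move=> fgr fgx fgy; apply: tgwpa_gen => [z w Hz Hw|z w Hz Hw|z].
- by rewrite !linearD /= Hz Hw.
- by rewrite !rmorphM /= Hz Hw.
- by case=> [] [i ->].
Qed.

Section Lift.
Variables (B : comAlgType k) (phi : {lrmorphism R -> B}) (X Y : 'I_n -> B).
Hypothesis YX : forall i, Y i * X i = phi (td_a D i).

Let ev (p : M) : B :=
  mmap phi (fun u => match split u with inl i => X i | inr i => Y i end) p.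

(** By [YX], evaluation kills each [y_i x_i - a_i], hence the ideal that these generate. *)
Let ev_pi p q : tgwpa_pi D p = tgwpa_pi D q -> ev p = ev q.
Proof.
move=> /tgwpa_piP[f pq]; apply/eqP; rewrite -subr_eq0 -[ev p - ev q]rmorphB pq.
rewrite rmorph_sum big1 //= => i _; rewrite rmorphM rmorphB rmorphM /=.
rewrite !mmapX !mmap1U mmapC -[lshift n i]/(unsplit (inl i)).
by rewrite -[rshift n i]/(unsplit (inr i)) !unsplitK YX subrr mulr0.
Qed.

(* [YX] is an argument so that the morphism structure is inferred. *)
Definition tgwpa_lift of (forall i, Y i * X i = phi (td_a D i)) :=
  fun z : tgwpa D => ev (repr z).

Local Notation lift := (tgwpa_lift YX).

Let lift_pi p : lift (tgwpa_pi D p) = ev p.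
Proof. by apply: ev_pi; rewrite tgwpa_reprK. Qed.

Lemma tgwpa_lift_monoid_morphism : monoid_morphism lift.
Proof.
split=> [|z w]; first by rewrite -tgwpa_pi1 lift_pi [LHS]rmorph1.
by rewrite -[z]tgwpa_reprK -[w]tgwpa_reprK -tgwpa_piM !lift_pi [LHS]rmorphM.
Qed.

Lemma tgwpa_lift_linear : linear lift.
Proof.
move=> c z w; rewrite tgwpa_scaleE -[z]tgwpa_reprK -[w]tgwpa_reprK.
rewrite -tgwpa_piM -tgwpa_piD !lift_pi [LHS]rmorphD [X in X + _]rmorphM /=.
by rewrite {1}/scal mmapC /= linearZ /= rmorph1 -scalerAl mul1r.
Qed.

HB.instance Definition _ :=
  GRing.isLinear.Build k (tgwpa D) B *:%R lift tgwpa_lift_linear.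
HB.instance Definition _ :=
  GRing.isMonoidMorphism.Build (tgwpa D) B lift tgwpa_lift_monoid_morphism.

Lemma tgwpa_lift_in r : lift (tgwpa_in D r) = phi r.
Proof. by rewrite lift_pi /ev mmapC. Qed.
Lemma tgwpa_lift_x i : lift (tgwpa_x D i) = X i.
Proof.
by rewrite lift_pi /ev mmapX mmap1U -[lshift n i]/(unsplit (inl i)) unsplitK.
Qed.
Lemma tgwpa_lift_y i : lift (tgwpa_y D i) = Y i.
Proof.
by rewrite lift_pi /ev mmapX mmap1U -[rshift n i]/(unsplit (inr i)) unsplitK.
Qed.

End Lift.
End TGWPALift.

(** * Functoriality of TGWPAs in their data *)

(** The difference of the two scalars annihilates [a_i], and the regular element [a_i] can be
    cancelled. *)
Lemma td_gamma_unique (k : fieldType) (R : poissonAlgType k) (n : nat)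
    (D : tgwpa_datum R n) i j (c : k) : i != j ->
  td_der D j (td_a D i) = c *: td_a D i -> td_gamma D i j = c.
Proof.
move=> ij; rewrite td_der_a // => /eqP.
rewrite -subr_eq0 -scalerBl -(mulr0 (td_a D i)) -[_ *: _]mulr_algr.
rewrite (inj_eq (@td_a_regular _ _ _ D i)) scaler_eq0 oner_eq0 orbF subr_eq0.
by move/eqP.
Qed.

Lemma td_der_linear (k : fieldType) (R : poissonAlgType k) (n : nat)
    (D : tgwpa_datum R n) i : linear (td_der D i).
Proof. by have [] := td_derP D i. Qed.
#[local] Hint Extern 0 (linear _) => exact: td_der_linear : core.

Section TGWPAMap.
Variables (k : fieldType) (R S : poissonAlgType k) (n N : nat).
Variables (D : tgwpa_datum R n) (E : tgwpa_datum S N).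
Variables (phi : {lrmorphism R -> S}) (iota : 'I_n -> 'I_N).
Hypothesis phi_poisson : poisson_morph phi.
Hypothesis iota_inj : injective iota.
Hypothesis derE : forall i r, td_der E (iota i) (phi r) = phi (td_der D i r).
Hypothesis aE : forall i, td_a E (iota i) = phi (td_a D i).
Hypothesis muE : forall i j, td_mu E (iota i) (iota j) = td_mu D i j.

Lemma tgwpa_map_yx i : tgwpa_y E (iota i) * tgwpa_x E (iota i)
  = (tgwpa_in E \o phi) (td_a D i).
Proof. by rewrite tgwpa_yx aE. Qed.

(** It acts by [phi] on coefficients and reindexes the variables along [iota]. It will be used for
    the two inclusions into [R ⊗ R'], with [iota] equal to [lshift] or [rshift]. *)
Definition tgwpa_map : {lrmorphism tgwpa D -> tgwpa E} := tgwpa_lift tgwpa_map_yx.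

Lemma tgwpa_map_in r : tgwpa_map (tgwpa_in D r) = tgwpa_in E (phi r).
Proof. exact: tgwpa_lift_in. Qed.
Lemma tgwpa_map_x i : tgwpa_map (tgwpa_x D i) = tgwpa_x E (iota i).
Proof. exact: tgwpa_lift_x. Qed.
Lemma tgwpa_map_y i : tgwpa_map (tgwpa_y D i) = tgwpa_y E (iota i).
Proof. exact: tgwpa_lift_y. Qed.

(** Applying [phi] to the eigenvalue equation of [a_i] gives that of its image, whose eigenvalue is
    unique. *)
Lemma tgwpa_map_gamma i j : i != j ->
  td_gamma E (iota i) (iota j) = td_gamma D i j.
Proof.
move=> ij; apply: td_gamma_unique; first by rewrite (inj_eq iota_inj).
by rewrite aE derE td_der_a // linearZ.
Qed.

Lemma tgwpa_map_poisson : poisson_morph tgwpa_map.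
Proof.
have Fin := tgwpa_map_in; have Fx := tgwpa_map_x; have Fy := tgwpa_map_y.
(* Injectivity of [iota] lets the off-diagonal formulas apply on both sides at once. *)
have neq i j : i != j -> iota i != iota j by rewrite (inj_eq iota_inj).
have Fpbrxx i j : tgwpa_map (pbr (tgwpa_x D i) (tgwpa_x D j))
    = pbr (tgwpa_x E (iota i)) (tgwpa_x E (iota j)).
  have [<-|ij] := eqVneq i j; first by rewrite !pbrxx raddf0.
  rewrite !tgwpa_pbr_x_x ?neq // linearZ rmorphM /= !Fx.
  by rewrite muE tgwpa_map_gamma.
have Fpbryy i j : tgwpa_map (pbr (tgwpa_y D i) (tgwpa_y D j))
    = pbr (tgwpa_y E (iota i)) (tgwpa_y E (iota j)).
  have [<-|ij] := eqVneq i j; first by rewrite !pbrxx raddf0.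
  rewrite !tgwpa_pbr_y_y ?neq // linearZ rmorphM /= !Fy.
  by rewrite muE tgwpa_map_gamma.
have Fpbryx i j : tgwpa_map (pbr (tgwpa_y D i) (tgwpa_x D j))
    = pbr (tgwpa_y E (iota i)) (tgwpa_x E (iota j)).
  have [<-|ij] := eqVneq i j; first by rewrite !tgwpa_pbr_y_x [LHS]Fin aE derE.
  by rewrite !tgwpa_pbr_y_x_neq ?neq // linearZ rmorphM /= Fy Fx muE.
have Fpbrrx r j : tgwpa_map (pbr (tgwpa_in D r) (tgwpa_x D j))
    = pbr (tgwpa_in E (phi r)) (tgwpa_x E (iota j)).
  by rewrite !tgwpa_pbr_in_x rmorphM /= Fin Fx derE.
have Fpbrry r j : tgwpa_map (pbr (tgwpa_in D r) (tgwpa_y D j))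
    = pbr (tgwpa_in E (phi r)) (tgwpa_y E (iota j)).
  by rewrite !tgwpa_pbr_in_y rmorphN rmorphM /= Fin Fy derE.
(* Of the nine kinds of pairs of generators, those in the order opposite to a fact above reduce to
   it by antisymmetry. *)
apply: (poisson_morph_gen (@tgwpa_gen _ _ _ D)) => z w.
case=> [] [i ->] [] [j ->].
- by rewrite tgwpa_pbr_in !Fin tgwpa_pbr_in phi_poisson.
- by rewrite Fpbrrx Fin Fx.
- by rewrite Fpbrry Fin Fy.
- by rewrite pbrC linearN /= Fpbrrx -pbrC Fin Fx.
- by rewrite Fpbrxx !Fx.
- by rewrite pbrC linearN /= Fpbryx -pbrC Fx Fy.
- by rewrite pbrC linearN /= Fpbrry -pbrC Fin Fy.
- by rewrite Fpbryx Fx Fy.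
- by rewrite Fpbryy !Fy.
Qed.

End TGWPAMap.

(** * Poisson derivations and central elements of a tensor product *)

Section TensorDerivations.
Variables (k : fieldType) (B C : poissonAlgType k).

Lemma tensor_map_inl (d : B -> B) b : linear d ->
  tensor_map d (idfun : C -> C) (tensor_inl C b) = tensor_inl C (d b).
Proof. by move=> dL; apply: tensor_mapE. Qed.
Lemma tensor_map_inr (d : C -> C) c : linear d ->
  tensor_map (idfun : B -> B) d (tensor_inr B c) = tensor_inr B (d c).
Proof. by move=> dL; apply: tensor_mapE. Qed.

(** Everything is checked on pure tensors. The tensor bracket has the summand [b b' ⊗ {c, c'}], so
    compatibility with it uses the Leibniz rule of [d] besides its compatibility with the bracket of
    [B]. *)
Lemma tensor_map_derl (d : B -> B) : poisson_derivation d ->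
  poisson_derivation (tensor_map d (idfun : C -> C)).
Proof.
move=> [dL dM dB]; pose T := tensor_map d (idfun : C -> C).
have TL : linear T by exact: tensor_map_linear.
have TD x y : T (x + y) = T x + T y by have := TL 1 x y; rewrite !scale1r.
have TE b c : T (b ⊗ c) = d b ⊗ c by exact: tensor_mapE.
have dD b b' : d (b + b') = d b + d b' by have := dL 1 b b'; rewrite !scale1r.
split=> // x y; rewrite -/T.
  elim/tensor_ind: x => [x x' Hx Hx'|b c].
    by rewrite mulrDl !TD Hx Hx' !mulrDl addrACA.
  elim/tensor_ind: y => [y y' Hy Hy'|b' c'].
    by rewrite mulrDr !TD Hy Hy' !mulrDr addrACA.
  by rewrite tensorM !TE !tensorM dM tensorDl.
elim/tensor_ind: x => [x x' Hx Hx'|b c].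
  by rewrite pbrDl !TD Hx Hx' !pbrDl addrACA.
elim/tensor_ind: y => [y y' Hy Hy'|b' c'].
  by rewrite pbrDr !TD Hy Hy' !pbrDr addrACA.
by rewrite pbr_tensor TD !TE !pbr_tensor dB dM !tensorDl addrACA.
Qed.

Lemma tensor_map_derr (d : C -> C) : poisson_derivation d ->
  poisson_derivation (tensor_map (idfun : B -> B) d).
Proof.
move=> [dL dM dB]; pose T := tensor_map (idfun : B -> B) d.
have TL : linear T by exact: tensor_map_linear.
have TD x y : T (x + y) = T x + T y by have := TL 1 x y; rewrite !scale1r.
have TE b c : T (b ⊗ c) = b ⊗ d c by exact: tensor_mapE.
split=> // x y; rewrite -/T.
  elim/tensor_ind: x => [x x' Hx Hx'|b c].
    by rewrite mulrDl !TD Hx Hx' !mulrDl addrACA.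
  elim/tensor_ind: y => [y y' Hy Hy'|b' c'].
    by rewrite mulrDr !TD Hy Hy' !mulrDr addrACA.
  by rewrite tensorM !TE !tensorM dM tensorDr.
elim/tensor_ind: x => [x x' Hx Hx'|b c].
  by rewrite pbrDl !TD Hx Hx' !pbrDl addrACA.
elim/tensor_ind: y => [y y' Hy Hy'|b' c'].
  by rewrite pbrDr !TD Hy Hy' !pbrDr addrACA.
by rewrite pbr_tensor TD !TE !pbr_tensor dB dM !tensorDr addrACA.
Qed.

Lemma poisson_central_inl (b : B) :
  poisson_central b -> poisson_central (tensor_inl C b).
Proof.
move=> bc; elim/tensor_ind=> [x y Hx Hy|b' c]; first by rewrite pbrDr Hx Hy addr0.
by rewrite pbr_tensor bc pbr1l tensor0l tensor0r addr0.
Qed.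

Lemma poisson_central_inr (c : C) :
  poisson_central c -> poisson_central (tensor_inr B c).
Proof.
move=> cc; elim/tensor_ind=> [x y Hx Hy|b c']; first by rewrite pbrDr Hx Hy addr0.
by rewrite pbr_tensor cc pbr1l tensor0l tensor0r addr0.
Qed.

End TensorDerivations.

(** * The datum on the tensor product of the base algebras *)

Section TensorDatum.
Variables (k : fieldType) (R R' : poissonAlgType k) (n m : nat).
Variables (D : tgwpa_datum R n) (D' : tgwpa_datum R' m).
Local Notation S := (tensor R R').

Definition tensor_der (u : 'I_(n + m)) : S -> S :=
  match split u with
  | inl i => tensor_map (td_der D i) idfun
  | inr j => tensor_map idfun (td_der D' j)
  end.

Definition tensor_a (u : 'I_(n + m)) : S :=
  match split u with
  | inl i => tensor_inl R' (td_a D i)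
  | inr j => tensor_inr R (td_a D' j)
  end.

Lemma tensor_der_lshift i :
  tensor_der (lshift m i) = tensor_map (td_der D i) idfun.
Proof. by rewrite /tensor_der (unsplitK (inl i)). Qed.
Lemma tensor_der_rshift j :
  tensor_der (rshift n j) = tensor_map idfun (td_der D' j).
Proof. by rewrite /tensor_der (unsplitK (inr j)). Qed.
Lemma tensor_a_lshift i : tensor_a (lshift m i) = tensor_inl R' (td_a D i).
Proof. by rewrite /tensor_a (unsplitK (inl i)). Qed.
Lemma tensor_a_rshift j : tensor_a (rshift n j) = tensor_inr R (td_a D' j).
Proof. by rewrite /tensor_a (unsplitK (inr j)). Qed.

Lemma tensor_derP u : poisson_derivation (tensor_der u).
Proof.
rewrite /tensor_der; case: (split u) => i.
  exact/tensor_map_derl/td_derP.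
exact/tensor_map_derr/td_derP.
Qed.

(** Derivations from the same factor commute by hypothesis; those from different factors act on
    opposite sides of a pure tensor. *)
Lemma tensor_derC u v x :
  tensor_der u (tensor_der v x) = tensor_der v (tensor_der u x).
Proof.
have derD w x' y : tensor_der w (x' + y) = tensor_der w x' + tensor_der w y.
  by have [L _ _] := tensor_derP w; have := L 1 x' y; rewrite !scale1r.
elim/tensor_ind: x => [x y Hx Hy|b c]; first by rewrite !derD Hx Hy.
rewrite /tensor_der; case: (split u) (split v) => i [] j;
  rewrite ![tensor_map _ _ (b ⊗ c)]tensor_mapE // !tensor_mapE //=.
  by rewrite td_derC.
by rewrite td_derC.
Qed.

Lemma tensor_a_central u : poisson_central (tensor_a u).
Proof.
rewrite /tensor_a; case: (split u) => i.
  exact/poisson_central_inl/td_a_central.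
exact/poisson_central_inr/td_a_central.
Qed.

Lemma tensor_a_regular u : GRing.lreg (tensor_a u).
Proof.
rewrite /tensor_a; case: (split u) => i.
  exact/tensor_inl_lreg/td_a_regular.
exact/tensor_inr_lreg/td_a_regular.
Qed.

(** [gamma] is block diagonal: across the blocks the derivation meets the factor [1] of [a ⊗ 1] or
    [1 ⊗ a'] and kills it. *)
Lemma tensor_der_a u v : u != v -> tensor_der v (tensor_a u) =
  block_mx (td_gamma D) 0 0 (td_gamma D') u v *: tensor_a u.
Proof.
case: (split_ordP u) => i ->; case: (split_ordP v) => j ->;
  rewrite ?block_mxEul ?block_mxEur ?block_mxEdl ?block_mxEdr
    ?tensor_a_lshift ?tensor_a_rshift ?tensor_der_lshift ?tensor_der_rshift.
- rewrite (inj_eq (@lshift_inj _ _)) => ij.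
  by rewrite tensor_map_inl // td_der_a // linearZ.
- rewrite tensor_mapE // td_der1 tensor0r.
  by rewrite mxE scale0r.
- rewrite tensor_mapE // td_der1 tensor0l.
  by rewrite mxE scale0r.
- rewrite (inj_eq (@rshift_inj _ _)) => ij.
  by rewrite tensor_map_inr // td_der_a // linearZ.
Qed.

Lemma tensor_gamma_mu u v : u != v ->
  block_mx (td_gamma D) 0 0 (td_gamma D') u v
    + block_mx (td_gamma D) 0 0 (td_gamma D') v u
  = block_mx (td_mu D) 0 0 (td_mu D') u v
    + block_mx (td_mu D) 0 0 (td_mu D') v u.
Proof.
case: (split_ordP u) => i ->; case: (split_ordP v) => j ->;
  rewrite ?block_mxEul ?block_mxEur ?block_mxEdl ?block_mxEdr ?mxE //.
  by rewrite (inj_eq (@lshift_inj _ _)) => /td_gamma_mu.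
by rewrite (inj_eq (@rshift_inj _ _)) => /td_gamma_mu.
Qed.

Lemma tensor_datum_exists :
  exists E : tgwpa_datum (tensor R R') (n + m), tensor_datum D D' E.
Proof.
exists (TGWPADatum tensor_derP tensor_derC tensor_a_central tensor_a_regular
  tensor_der_a tensor_gamma_mu); split=> //= i.
- by rewrite tensor_der_lshift.
- by rewrite tensor_der_rshift.
- exact: tensor_a_lshift.
- exact: tensor_a_rshift.
Qed.

End TensorDatum.

(** * The isomorphism and its inverse *)

Section TensorIsomorphism.
Variables (k : fieldType) (R R' : poissonAlgType k) (n m : nat).
Variables (D : tgwpa_datum R n) (D' : tgwpa_datum R' m).
Variables (E : tgwpa_datum (tensor R R') (n + m)) (DE : tensor_datum D D' E).

Let der_ll i r : td_der E (lshift m i) (tensor_inl R' r) = tensor_inl R' (td_der D i r).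
Proof. by have [_ -> _ _ _] := DE; apply: tensor_map_inl. Qed.
Let der_rr j r : td_der E (rshift n j) (tensor_inr R r) = tensor_inr R (td_der D' j r).
Proof. by have [_ _ -> _ _] := DE; apply: tensor_map_inr. Qed.
Let der_lr i r : td_der E (lshift m i) (tensor_inr R r) = 0.
Proof.
by have [_ -> _ _ _] := DE; rewrite tensor_mapE // td_der1 tensor0l.
Qed.
Let der_rl j r : td_der E (rshift n j) (tensor_inl R' r) = 0.
Proof.
by have [_ _ -> _ _] := DE; rewrite tensor_mapE // td_der1 tensor0r.
Qed.
Let a_l i : td_a E (lshift m i) = tensor_inl R' (td_a D i).
Proof. by have [_ _ _ -> _] := DE. Qed.
Let a_r j : td_a E (rshift n j) = tensor_inr R (td_a D' j).
Proof. by have [_ _ _ _ ->] := DE. Qed.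
Let mu_ll i j : td_mu E (lshift m i) (lshift m j) = td_mu D i j.
Proof. by have [-> _ _ _ _] := DE; rewrite block_mxEul. Qed.
Let mu_rr i j : td_mu E (rshift n i) (rshift n j) = td_mu D' i j.
Proof. by have [-> _ _ _ _] := DE; rewrite block_mxEdr. Qed.
Let mu_lr i j : td_mu E (lshift m i) (rshift n j) = 0.
Proof. by have [-> _ _ _ _] := DE; rewrite block_mxEur mxE. Qed.
Let mu_rl i j : td_mu E (rshift n j) (lshift m i) = 0.
Proof. by have [-> _ _ _ _] := DE; rewrite block_mxEdl mxE. Qed.
(** [E] is arbitrary and its [gamma] is not prescribed, but the derivation from the right factor
    kills [a_i ⊗ 1], so uniqueness of the eigenvalue forces zero. *)
Let gamma_lr i j : td_gamma E (lshift m i) (rshift n j) = 0.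
Proof. by apply: td_gamma_unique; rewrite ?eq_lrshift // a_l der_rl scale0r. Qed.

Definition tensor_tgwpa_l : {lrmorphism tgwpa D -> tgwpa E} := tgwpa_map a_l.
Definition tensor_tgwpa_r : {lrmorphism tgwpa D' -> tgwpa E} := tgwpa_map a_r.

(** Each bracket between generators of different factors carries a coefficient that vanishes: a
    bracket of [r ⊗ 1] with [1 ⊗ r'], a derivation applied to the other factor, or a combination of
    entries of [mu] and [gamma] outside the diagonal blocks. *)
Lemma tensor_tgwpa_pbr0 z w : pbr (tensor_tgwpa_l z) (tensor_tgwpa_r w) = 0.
Proof.
pose f := tensor_tgwpa_l; pose g := tensor_tgwpa_r; rewrite -/f -/g.
move: z; apply: tgwpa_gen => [z z' Hz Hz'|z z' Hz Hz'|z gz].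
- by rewrite linearD /= pbrDl Hz Hz' addr0.
- by rewrite rmorphM /= pbr_leibnizl Hz Hz' mul0r mulr0 addr0.
move: w; apply: tgwpa_gen => [w w' Hw Hw'|w w' Hw Hw'|w gw].
- by rewrite linearD /= pbrDr Hw Hw' addr0.
- by rewrite rmorphM /= pbr_leibniz Hw Hw' mul0r mulr0 addr0.
have neq i j : lshift m i != rshift n j by rewrite eq_lrshift.
case: gz gw => [] [i ->] [] [j ->]; rewrite /f /g.
- rewrite !tgwpa_map_in tgwpa_pbr_in pbr_inl_inr; exact: raddf0.
- rewrite tgwpa_map_in tgwpa_map_x tgwpa_pbr_in_x der_rl.
  by rewrite [tgwpa_in E 0]raddf0 mul0r.
- rewrite tgwpa_map_in tgwpa_map_y tgwpa_pbr_in_y der_rl.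
  by rewrite [tgwpa_in E 0]raddf0 mul0r oppr0.
- rewrite tgwpa_map_in tgwpa_map_x pbrC tgwpa_pbr_in_x der_lr.
  by rewrite [tgwpa_in E 0]raddf0 mul0r oppr0.
- by rewrite !tgwpa_map_x tgwpa_pbr_x_x // gamma_lr mu_lr subrr scale0r.
- rewrite tgwpa_map_x tgwpa_map_y pbrC tgwpa_pbr_y_x_neq 1?eq_sym //.
  by rewrite mu_rl scale0r oppr0.
- rewrite tgwpa_map_in tgwpa_map_y pbrC tgwpa_pbr_in_y der_lr.
  by rewrite [tgwpa_in E 0]raddf0 mul0r !oppr0.
- by rewrite tgwpa_map_y tgwpa_map_x tgwpa_pbr_y_x_neq // mu_lr scale0r.
- by rewrite !tgwpa_map_y tgwpa_pbr_y_y // gamma_lr mu_rl subrr scale0r.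
Qed.

Definition tensor_tgwpa : {lrmorphism tensor (tgwpa D) (tgwpa D') -> tgwpa E} :=
  tensor_lift tensor_tgwpa_l tensor_tgwpa_r.

Lemma tensor_tgwpa_poisson : poisson_morph tensor_tgwpa.
Proof.
apply: tensor_lift_poisson tensor_tgwpa_pbr0; apply: tgwpa_map_poisson => //.
- exact: poisson_morph_inl.
- exact: lshift_inj.
- exact: poisson_morph_inr.
- exact: rshift_inj.
Qed.

Local Notation T := (tensor (tgwpa D) (tgwpa D')).

(** Together with [x_tensor] and [y_tensor], this prescribes the inverse on the coefficients and
    variables of [tgwpa E]. *)
Let in_tensor : {lrmorphism tensor R R' -> T} :=
  tensor_lift (@tensor_inl _ _ (tgwpa D') \o tgwpa_in D)
              (@tensor_inr _ (tgwpa D) _ \o tgwpa_in D').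
Let x_tensor (u : 'I_(n + m)) : T :=
  match split u with
  | inl i => tensor_inl _ (tgwpa_x D i)
  | inr j => tensor_inr _ (tgwpa_x D' j)
  end.
Let y_tensor (u : 'I_(n + m)) : T :=
  match split u with
  | inl i => tensor_inl _ (tgwpa_y D i)
  | inr j => tensor_inr _ (tgwpa_y D' j)
  end.

Let yx_tensor u : y_tensor u * x_tensor u = in_tensor (td_a E u).
Proof.
rewrite /x_tensor /y_tensor; case: split_ordP => i ->.
  by rewrite a_l -rmorphM tgwpa_yx [RHS]tensor_lift_inl.
by rewrite a_r -rmorphM tgwpa_yx [RHS]tensor_lift_inr.
Qed.

Lemma tensor_tgwpa_bij : bijective tensor_tgwpa.
Proof.
pose f := tensor_tgwpa; pose g : {lrmorphism tgwpa E -> T} := tgwpa_lift yx_tensor.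
have fl z : f (tensor_inl _ z) = tensor_tgwpa_l z := tensor_lift_inl _ _ z.
have fr z : f (tensor_inr _ z) = tensor_tgwpa_r z := tensor_lift_inr _ _ z.
have gin r : g (tgwpa_in E r) = in_tensor r := tgwpa_lift_in _ r.
have gx u : g (tgwpa_x E u) = x_tensor u := tgwpa_lift_x _ u.
have gy u : g (tgwpa_y E u) = y_tensor u := tgwpa_lift_y _ u.
have x_l i : x_tensor (lshift m i) = tensor_inl _ (tgwpa_x D i).
  by rewrite /x_tensor (unsplitK (inl i)).
have x_r j : x_tensor (rshift n j) = tensor_inr _ (tgwpa_x D' j).
  by rewrite /x_tensor (unsplitK (inr j)).
have y_l i : y_tensor (lshift m i) = tensor_inl _ (tgwpa_y D i).
  by rewrite /y_tensor (unsplitK (inl i)).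
have y_r j : y_tensor (rshift n j) = tensor_inr _ (tgwpa_y D' j).
  by rewrite /y_tensor (unsplitK (inr j)).
exists g => [z|z].
  (* An endomorphism of the tensor product is the identity once it is so on each factor, where the
     TGWPA generators decide. *)
  apply: (tensor_alg_eq (f := g \o f) (g := idfun)) => {}z.
    rewrite -[LHS]/(g (f _)) fl.
    apply: (tgwpa_alg_eq (f := g \o tensor_tgwpa_l)
                         (g := @tensor_inl _ _ (tgwpa D'))) => [r|i|i].
    - rewrite -[LHS]/(g (tensor_tgwpa_l _)) tgwpa_map_in gin; exact: tensor_lift_inl.
    - by rewrite -[LHS]/(g (tensor_tgwpa_l _)) tgwpa_map_x gx x_l.
    - by rewrite -[LHS]/(g (tensor_tgwpa_l _)) tgwpa_map_y gy y_l.
  rewrite -[LHS]/(g (f _)) fr.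
  apply: (tgwpa_alg_eq (f := g \o tensor_tgwpa_r)
                       (g := @tensor_inr _ (tgwpa D) _)) => [r|i|i].
  - rewrite -[LHS]/(g (tensor_tgwpa_r _)) tgwpa_map_in gin; exact: tensor_lift_inr.
  - by rewrite -[LHS]/(g (tensor_tgwpa_r _)) tgwpa_map_x gx x_r.
  - by rewrite -[LHS]/(g (tensor_tgwpa_r _)) tgwpa_map_y gy y_r.
apply: (tgwpa_alg_eq (f := f \o g) (g := idfun)) => [r|u|u].
- rewrite -[LHS]/(f (g _)) gin.
  (* The coefficients of [tgwpa E] form a tensor product, so they are again compared on the two
     factors. *)
  apply: (tensor_alg_eq (f := f \o in_tensor) (g := tgwpa_in E)) => {}r.
    rewrite -[LHS]/(f (in_tensor _)) [in_tensor _]tensor_lift_inl.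
    by rewrite [LHS]fl tgwpa_map_in.
  rewrite -[LHS]/(f (in_tensor _)) [in_tensor _]tensor_lift_inr.
  by rewrite [LHS]fr tgwpa_map_in.
- rewrite -[LHS]/(f (g _)) gx; case: (split_ordP u) => i ->.
    by rewrite x_l fl tgwpa_map_x.
  by rewrite x_r fr tgwpa_map_x.
- rewrite -[LHS]/(f (g _)) gy; case: (split_ordP u) => i ->.
    by rewrite y_l fl tgwpa_map_y.
  by rewrite y_r fr tgwpa_map_y.
Qed.

End TensorIsomorphism.

(** The first half ensures that the second is not vacuous. The second ranges over all [E] because
    [tensor_datum] leaves the diagonal of [gamma] free; its last three clauses express the canonical
    identification of generators. *)
Theorem proposition3p1 (k : fieldType) (R R' : poissonAlgType k) (n m : nat)
    (hn : (0 < n)%N) (hm : (0 < m)%N)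
    (D : tgwpa_datum R n) (D' : tgwpa_datum R' m) :
  (exists E : tgwpa_datum (tensor R R') (n + m), tensor_datum D D' E) /\
  (forall E : tgwpa_datum (tensor R R') (n + m), tensor_datum D D' E ->
   exists f : {lrmorphism tensor (tgwpa D) (tgwpa D') -> tgwpa E},
    [/\ bijective f,
        poisson_morph f,
        forall (r : R) (r' : R'),
          f (tgwpa_in D r ⊗ tgwpa_in D' r') = tgwpa_in E (r ⊗ r'),
        forall i : 'I_n,
          f (tgwpa_x D i ⊗ 1) = tgwpa_x E (lshift m i) /\
          f (tgwpa_y D i ⊗ 1) = tgwpa_y E (lshift m i)
      & forall j : 'I_m,
          f (1 ⊗ tgwpa_x D' j) = tgwpa_x E (rshift n j) /\
          f (1 ⊗ tgwpa_y D' j) = tgwpa_y E (rshift n j)]).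
Proof.
split=> [|E DE]; first exact: tensor_datum_exists.
have fl z : tensor_tgwpa DE (z ⊗ 1) = tensor_tgwpa_l DE z := tensor_lift_inl _ _ z.
have fr z : tensor_tgwpa DE (1 ⊗ z) = tensor_tgwpa_r DE z := tensor_lift_inr _ _ z.
exists (tensor_tgwpa DE); split=> [||r r'|i|j].
- exact: tensor_tgwpa_bij.
- exact: tensor_tgwpa_poisson.
- rewrite [LHS]tensor_liftE !tgwpa_map_in -[LHS]rmorphM; congr (tgwpa_in E _).
  by rewrite tensorM mulr1 mul1r.
- by rewrite !fl tgwpa_map_x tgwpa_map_y.
- by rewrite !fr tgwpa_map_x tgwpa_map_y.
Qed.
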